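(* Let $\gamma,\rho,\varepsilon\in(0,1]$, $\gamma'\in(1-\gamma,1]$ and $n\in\mathbb{Z}_{>0}$. Let $B\in\mathbb{R}_{\ge0}^{n\times n}$ be $(\gamma,\gamma',\rho)$-dense with respect to $(\boldsymbol{1},\boldsymbol{1})$. Let $A$ be a matrix with $UAV=B$ for some diagonal matrices $U,V$ with strictly positive diagonals, and let $$h=\max_{i,j\in[n]:\,A_{ij}>0}\frac{r_i(A)\,B_{ij}}{r_i(B)\,A_{ij}}.$$ Let $A^{(0)},A^{(1)},\dots$ be the SK iterates with input $(A,(\boldsymbol{1},\boldsymbol{1}))$. Then there exists $$k=O\Bigl(\frac{\log h-\log\varepsilon-\log\rho-\log(\gamma+\gamma'-1)}{\rho^{14}(\gamma+\gamma'-1)^{6}}\Bigr)$$ such that for all $\ell\ge k$, $\|\boldsymbol{r}(A^{(\ell)})-\boldsymbol{1}\|_1+\|\boldsymbol{c}(A^{(\ell)})-\boldsymbol{1}\|_1\le n\varepsilon$.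
   Context: $r_i,c_j$ denote row/column sums, $\boldsymbol{r},\boldsymbol{c}$ their vectors, $\boldsymbol{1}$ the all-ones vector. SK with input $(A,(\boldsymbol{1},\boldsymbol{1}))$: $A^{(0)}_{ij}=A_{ij}/r_i(A)$; odd $k$: $A^{(k)}_{ij}=A^{(k-1)}_{ij}/c_j(A^{(k-1)})$; even $k\ge2$: $A^{(k)}_{ij}=A^{(k-1)}_{ij}/r_i(A^{(k-1)})$. $O$ hides an absolute constant. For nonzero $M\in\mathbb{R}^{n\times n}_{\ge0}$ with $t=\max M_{ij}$, $M$ is $(\gamma,\gamma',\rho)$-dense with respect to $(\boldsymbol{1},\boldsymbol{1})$ if $\gamma=\min_i\frac1n|\{k:M_{ik}>\rho t\}|$ and $\gamma'=\min_j\frac1n|\{k:M_{kj}>\rho t\}|$. *)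

(* Defs.v *)
From HB Require Import structures.
From mathcomp Require Import all_boot all_order all_algebra.
From mathcomp Require Import reals exp.
Set Implicit Arguments.
Unset Strict Implicit.
Unset Printing Implicit Defensive.
Import Order.TTheory GRing.Theory Num.Theory.
Local Open Scope ring_scope.

Definition row_sum (R : realType) (n : nat) (A : 'M[R]_n) (i : 'I_n) : R :=
  \sum_(j < n) A i j.

Definition col_sum (R : realType) (n : nat) (A : 'M[R]_n) (j : 'I_n) : R :=
  \sum_(i < n) A i j.

Definition row_sums (R : realType) (n : nat) (A : 'M[R]_n) : 'rV[R]_n :=
  \row_(i < n) row_sum A i.

Definition col_sums (R : realType) (n : nat) (A : 'M[R]_n) : 'rV[R]_n :=
  \row_(j < n) col_sum A j.

Definition l1norm (R : realType) (n : nat) (v : 'rV[R]_n) : R :=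
  \sum_(j < n) `|v 0 j|.

Definition nonneg_mx (R : realType) (n : nat) (A : 'M[R]_n) : Prop :=
  forall i j, 0 <= A i j.

Definition normalize_rows (R : realType) (n : nat) (A : 'M[R]_n) : 'M[R]_n :=
  \matrix_(i < n, j < n) (A i j / row_sum A i).

Definition normalize_cols (R : realType) (n : nat) (A : 'M[R]_n) : 'M[R]_n :=
  \matrix_(i < n, j < n) (A i j / col_sum A j).

(* Sinkhorn-Knopp iterates for the target marginals (1, 1). *)
Fixpoint SK (R : realType) (n : nat) (A : 'M[R]_n) (k : nat) : 'M[R]_n :=
  if k is k'.+1 then
    if odd k then normalize_cols (SK A k') else normalize_rows (SK A k')
  else normalize_rows A.

(* The default 0 is harmless: it is only used for nonnegative matrices. *)
Definition max_entry (R : realType) (n : nat) (M : 'M[R]_n) : R :=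
  \big[Num.max/0]_(i < n) \big[Num.max/0]_(j < n) M i j.

(* In the two minima the default 1 is harmless for n > 0, because every
   proportion is at most 1. *)
Definition min_row_density (R : realType) (n : nat) (rho : R) (M : 'M[R]_n)
    : R :=
  \big[Num.min/1]_(i < n)
    (#|[set k : 'I_n | M i k > rho * max_entry M]|%:R / n%:R).

Definition min_col_density (R : realType) (n : nat) (rho : R) (M : 'M[R]_n)
    : R :=
  \big[Num.min/1]_(j < n)
    (#|[set k : 'I_n | M k j > rho * max_entry M]|%:R / n%:R).

(* Density with respect to the target marginals (1, 1). *)
Definition dense (R : realType) (n : nat) (gamma gamma' rho : R)
    (M : 'M[R]_n) : Prop :=
  [/\ M != 0, nonneg_mx M,
      gamma = min_row_density rho M & gamma' = min_col_density rho M].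

(* The maximum of (r_i(A) B_ij) / (r_i(B) A_ij) over the pairs (i, j) with
   A_ij > 0. The default 0 is harmless: the ratios are nonnegative for
   nonnegative A and B, and there is such a pair whenever A is nonzero. *)
Definition scaling_ratio (R : realType) (n : nat) (A B : 'M[R]_n) : R :=
  \big[Num.max/0]_(i < n) \big[Num.max/0]_(j < n | 0 < A i j)
    ((row_sum A i * B i j) / (row_sum B i * A i j)).

(* Main.v *)
(* Let [P] be the doubly stochastic scaling of [B]. The iterates have the form
   [x_i P_ij y_j], and a round of two normalizations maps [y] to the column-wise
   [P]-harmonic mean of the row-wise [P]-arithmetic means of [y]. Both [y] and
   [1 / y] are thus dominated by their images under [P^T P], so that a Doeblin
   minorization of [P^T P] (or of [P P^T], for the row scaling) makes
   [max y / min y - 1] decay geometrically, and this quantity bounds the L1 error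
   divided by [n].

   Density gives the minorization: as the degrees satisfy [gamma + gamma' > 1],
   the scaling factors [a], [b] of [P] satisfy [a_i b_j = O(1 / (n rho^2
   delta^3))] with [delta = gamma + gamma' - 1], and one of [gamma], [gamma']
   exceeds [1 / 2], so any two columns (or any two rows) share [delta n] large
   entries. *)
From mathcomp Require Import classical_sets topology normedtype sequences derive.
Require Import Defs.
From HB Require Import structures.
From mathcomp Require Import all_boot all_order all_algebra.
From mathcomp Require Import reals exp.
From mathcomp Require Import ring lra zify.
Set Implicit Arguments.
Unset Strict Implicit.
Unset Printing Implicit Defensive.
Import Order.TTheory GRing.Theory Num.Theory numFieldNormedType.Exports.
Local Open Scope ring_scope.

(** The existence of [P] is itself proved, by minimizing the capacity of [B]; its coercivity rests
    on row and column degrees summing to more than [n]. Tracking [max y / min y - 1] rather than its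
    logarithm gives one geometric rate for large and small spreads alike, so a single phase leads
    from the initial spread to [eps]. The factor is [1 - alpha / 2] per two rounds, with
    [alpha = rho^4 delta^4 / 27]; the 27 arises from cutting the degree excess into thirds. Thus the
    number of rounds is of order [1 / (rho^4 delta^4)] times the logarithmic term, which the claimed
    denominator [rho^14 delta^6] dominates. *)

(** * Weighted means and contraction of the spread *)

Definition stochastic (R : realType) (n : nat) (P : 'M[R]_n) : Prop :=
  (forall i j, 0 <= P i j) /\ (forall i, \sum_j P i j = 1).

Definition bistochastic (R : realType) (n : nat) (P : 'M[R]_n) : Prop :=
  stochastic P /\ stochastic P^T.

(* Normalizing the rows of the matrix [x_i P_ij y_j] replaces [x] by
   [rescale P y]. *)
Definition rescale (R : realType) (n : nat) (P : 'M[R]_n) (y : 'I_n -> R)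
    (i : 'I_n) : R :=
  (\sum_j P i j * y j)^-1.

(** An upper bound on [max y / min y]; the existential [m] avoids naming extremal indices. *)
Definition spread (R : realType) (n : nat) (kappa : R) (y : 'I_n -> R) : Prop :=
  exists2 m : R, 0 < m & forall j, m <= y j <= kappa * m.

Lemma wmean_le (R : realType) (n : nat) (p z : 'I_n -> R) (M : R) :
  (forall j, 0 <= p j) -> \sum_j p j = 1 -> (forall j, z j <= M) ->
  \sum_j p j * z j <= M.
Proof.
move=> p0 p1 zM; rewrite -[leRHS]mul1r -p1 mulr_suml.
by apply: ler_sum => j _; rewrite ler_wpM2l.
Qed.

Lemma wmean_ge (R : realType) (n : nat) (p z : 'I_n -> R) (m : R) :
  (forall j, 0 <= p j) -> \sum_j p j = 1 -> (forall j, m <= z j) ->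
  m <= \sum_j p j * z j.
Proof.
move=> p0 p1 zM; rewrite -[leLHS]mul1r -p1 mulr_suml.
by apply: ler_sum => j _; rewrite ler_wpM2l.
Qed.

Lemma wmean_gt0 (R : realType) (n : nat) (p z : 'I_n -> R) :
  (forall j, 0 <= p j) -> \sum_j p j = 1 -> (forall j, 0 < z j) ->
  0 < \sum_j p j * z j.
Proof.
move=> p0 p1 z0.
have pz0 j : true -> 0 <= p j * z j by move=> _; rewrite mulr_ge0 // ltW.
rewrite lt0r sumr_ge0 // andbT; apply/negP => /eqP /psumr_eq0P -/(_ pz0) s0.
have : \sum_j p j = 0.
  apply: big1 => j _; have /eqP := s0 j isT.
  by rewrite mulf_eq0 (gt_eqF (z0 j)) orbF => /eqP.
by rewrite p1 => /eqP; rewrite oner_eq0.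
Qed.

Lemma wharmonic_le (R : realType) (n : nat) (p z : 'I_n -> R) :
  (forall j, 0 <= p j) -> \sum_j p j = 1 -> (forall j, 0 < z j) ->
  (\sum_j p j * z j)^-1 <= \sum_j p j * (z j)^-1.
Proof.
move=> p0 p1 z0; have c0 := wmean_gt0 p0 p1 z0.
set c := \sum_j p j * z j in c0 *.
(* the tangent line of [1 / z] at [c] *)
have tangent j : 2 / c - z j / c ^+ 2 <= (z j)^-1.
  have zj0 := z0 j.
  rewrite -subr_ge0.
  have -> : (z j)^-1 - (2 / c - z j / c ^+ 2) = (z j - c) ^+ 2 / (z j * c ^+ 2).
    by field; rewrite ?gt_eqF.
  by rewrite divr_ge0 ?sqr_ge0 // mulr_ge0 ?sqr_ge0 // ltW.
apply: le_trans (_ : \sum_j p j * (2 / c - z j / c ^+ 2) <= _); last first.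
  by apply: ler_sum => j _; rewrite ler_wpM2l.
under eq_bigr => j _ do rewrite mulrBr mulrA.
rewrite sumrB -!mulr_suml p1.
have -> : \sum_i p i * (z i / c ^+ 2) = c / c ^+ 2.
  by rewrite mulr_suml; apply: eq_bigr => j _; rewrite mulrA.
have -> : 1 * 2 / c - c / c ^+ 2 = c^-1 by field; rewrite gt_eqF.
by [].
Qed.

(** The remainder [q - alpha w] is nonnegative of total mass [1 - alpha]; only on it is [z] replaced
    by its bound [M]. *)
Lemma minorized_mean_le (R : realType) (n : nat) (q w z : 'I_n -> R) (alpha M : R) :
  \sum_j q j = 1 -> \sum_j w j = 1 ->
  (forall j, alpha * w j <= q j) -> (forall j, z j <= M) ->
  \sum_j q j * z j <= (1 - alpha) * M + alpha * \sum_j w j * z j.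
Proof.
move=> q1 w1 qw zM.
have : 0 <= \sum_j (q j - alpha * w j) * (M - z j).
  by apply: sumr_ge0 => j _; rewrite mulr_ge0 ?subr_ge0.
have -> : \sum_j (q j - alpha * w j) * (M - z j) =
    (\sum_j q j) * M - (\sum_j q j * z j) - alpha * ((\sum_j w j) * M)
      + alpha * \sum_j w j * z j.
  rewrite !mulr_suml !mulr_sumr -!sumrB -big_split /=.
  by apply: eq_bigr => j _; ring.
rewrite q1 w1 !mul1r.
set a := \sum_j _; set b := \sum_j _; lra.
Qed.

Lemma rescale_gt0 (R : realType) (n : nat) (P : 'M[R]_n) (y : 'I_n -> R) :
  stochastic P -> (forall j, 0 < y j) -> forall i, 0 < rescale P y i.
Proof. by move=> [P0 P1] y0 i; rewrite invr_gt0; exact: (@wmean_gt0 _ _ (P i)). Qed.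

Lemma spread_ge1 (R : realType) (n : nat) (kappa : R) (y : 'I_n -> R) :
  (0 < n)%N -> spread kappa y -> 1 <= kappa.
Proof.
case: n y => // n y _ [m m0 /(_ ord0) /andP[a b]].
by have := le_trans a b; rewrite ler_pMl.
Qed.

Lemma spread_rescale (R : realType) (n : nat) (P : 'M[R]_n) (kappa : R)
    (y : 'I_n -> R) :
  0 < kappa -> stochastic P -> spread kappa y -> spread kappa (rescale P y).
Proof.
move=> k0 [P0 P1] [m m0 ym].
exists (kappa * m)^-1 => [|i]; first by rewrite invr_gt0 mulr_gt0.
have y0 j : 0 < y j by case/andP: (ym j) => + _; exact: lt_le_trans.
have f0 : 0 < \sum_j P i j * y j by apply: (@wmean_gt0 _ _ (P i)).
apply/andP; split.
  rewrite lef_pV2 ?posrE ?mulr_gt0 //.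
  by apply: (@wmean_le _ _ (P i)) => // j; case/andP: (ym j).
have -> : kappa * (kappa * m)^-1 = m^-1.
  by field; rewrite !gt_eqF.
rewrite lef_pV2 ?posrE //.
by apply: (@wmean_ge _ _ (P i)) => // j; case/andP: (ym j).
Qed.

(* Harmonic means are below arithmetic means, so with [Q = P^T P] the image
   [y'] of [y] satisfies both [y' <= Q y] and [1 / y' <= Q (1 / y)]; the mass
   [alpha w] common to all the rows of [Q] pulls the two extrema together. *)
Lemma spread_contract (R : realType) (n : nat) (P : 'M[R]_n) (w : 'I_n -> R)
    (alpha kappa : R) (y : 'I_n -> R) :
  bistochastic P -> 0 <= alpha <= 1 -> (forall j, 0 <= w j) ->
  \sum_j w j = 1 ->
  (forall j l, alpha * w l <= \sum_i P i j * P i l) ->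
  1 <= kappa -> spread kappa y ->
  spread (1 + (1 - alpha / 2) * (kappa - 1)) (rescale P^T (rescale P y)).
Proof.
move=> [[P0 P1] [PT0 PT1]] /andP[a0 a1] w0 w1 Qw k1 [m m0 ym].
have k0 : 0 < kappa by apply: lt_le_trans k1.
have y0 j : 0 < y j by case/andP: (ym j) => + _; exact: lt_le_trans.
set M := kappa * m in ym *.
have M0 : 0 < M by rewrite mulr_gt0.
pose q j l := \sum_i P i j * P i l.
have Pc j : \sum_i P i j = 1.
  by rewrite -[RHS](PT1 j); apply: eq_bigr => i _; rewrite mxE.
have q1 j : \sum_l q j l = 1.
  rewrite exchange_big /= -[RHS](Pc j).
  by apply: eq_bigr => i _; rewrite -mulr_sumr -[RHS]mulr1 -(P1 i).
have q2 j z : \sum_i P i j * (\sum_l P i l * z l) = \sum_l q j l * z l.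
  under eq_bigr => i _ do rewrite mulr_sumr.
  rewrite exchange_big /=; apply: eq_bigr => l _.
  by rewrite mulr_suml; apply: eq_bigr => i _; rewrite mulrA.
pose f i := \sum_l P i l * y l.
have f0 i : 0 < f i by apply: (@wmean_gt0 _ _ (P i)).
have hE j : rescale P^T (rescale P y) j = (\sum_i P i j * (f i)^-1)^-1.
  by congr (_^-1); apply: eq_bigr => i _; rewrite mxE.
have h0 j : 0 < \sum_i P i j * (f i)^-1.
  by apply: (@wmean_gt0 _ _ (P^~ j)) => // i; rewrite invr_gt0.
have up j : rescale P^T (rescale P y) j <= \sum_l q j l * y l.
  rewrite hE -q2; apply: le_trans (@wharmonic_le _ _ (P^~ j) _ _ _ _) _ => //.
    by move=> i; rewrite invr_gt0.
  by under eq_bigr => i _ do rewrite invrK.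
have lo j : \sum_i P i j * (f i)^-1 <= \sum_l q j l * (y l)^-1.
  rewrite -q2; apply: ler_sum => i _; rewrite ler_wpM2l //.
  exact: (@wharmonic_le _ _ (P i)).
pose s := \sum_l w l * y l; pose t := \sum_l w l * (y l)^-1.
have upM j : \sum_l q j l * y l <= (1 - alpha) * M + alpha * s.
  by apply: (minorized_mean_le (q1 j) w1 (Qw j)) => l; case/andP: (ym l).
have loM j : \sum_l q j l * (y l)^-1 <= (1 - alpha) * m^-1 + alpha * t.
  apply: (minorized_mean_le (q1 j) w1 (Qw j)) => l; rewrite lef_pV2 ?posrE //.
  by case/andP: (ym l).
have sM : s <= M by apply: wmean_le => // l; case/andP: (ym l).
have s0 : 0 < s by apply: wmean_gt0.
have t0 : 0 < t by apply: wmean_gt0 => // l; rewrite invr_gt0.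
have tm : t <= m^-1.
  by apply: wmean_le => // l; rewrite lef_pV2 ?posrE //; case/andP: (ym l).
(* By convexity, [y / M + m / y] is largest on [[m, M]] at the endpoints. Hence the means of [y] and
   [1 / y] cannot both be near their maxima. *)
have st : s / M + t * m <= 1 + kappa^-1.
  rewrite !mulr_suml -big_split /=.
  have -> : \sum_j (w j * y j / M + w j * (y j)^-1 * m) =
            \sum_j w j * (y j / M + m / y j).
    by apply: eq_bigr => j _; ring.
  apply: wmean_le => // j; have /andP[y1 y2] := ym j; have yj0 := y0 j.
  rewrite -subr_ge0.
  have -> : 1 + kappa^-1 - (y j / M + m / y j) =
      (y j - m) * (M - y j) / (M * y j).
    by rewrite /M; field; rewrite !gt_eqF.
  by rewrite divr_ge0 ?mulr_ge0 ?subr_ge0 // ltW.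
pose p := s / M; pose r := t * m.
have p1 : p <= 1 by rewrite ler_pdivrMr // mul1r.
have r1 : r <= 1 by rewrite -ler_pdivlMr // mul1r.
have p0 : 0 < p by rewrite divr_gt0.
have r0 : 0 < r by rewrite mulr_gt0.
have mi0 : 0 < m^-1 by rewrite invr_gt0.
pose mu := (1 - alpha) * m^-1 + alpha * t.
have mu0 : 0 < mu.
  case: (ltrgtP alpha 1) a1 => // [a1 _|a1 _].
    by rewrite ltr_wpDr ?mulr_gt0 ?subr_gt0 // mulr_ge0 // ltW.
  by rewrite /mu a1 subrr mul0r add0r mul1r.
exists mu^-1 => [|j]; first by rewrite invr_gt0.
apply/andP; split.
  by rewrite hE lef_pV2 ?posrE //; exact: le_trans (loM j).
apply: le_trans (up j) _; apply: le_trans (upM j) _.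
rewrite ler_pdivlMr //.
have -> : ((1 - alpha) * M + alpha * s) * mu =
    kappa * ((1 - alpha * (1 - p)) * (1 - alpha * (1 - r))).
  by rewrite /mu /p /r /M; field; rewrite !gt_eqF.
have pr : p + r <= 1 + kappa^-1 by [].
(* With [x = alpha (1 - p)] and [z = alpha (1 - r)] in [[0, 1]], one has [x z <= (x + z) / 2]; this
   halving is the origin of [alpha / 2]. *)
have : (1 - alpha * (1 - p)) * (1 - alpha * (1 - r)) <=
    1 - alpha / 2 + alpha / 2 * kappa^-1.
  have : 0 <= alpha * (1 + kappa^-1 - (p + r)) by rewrite mulr_ge0 ?subr_ge0.
  have : 0 <= alpha * (1 - p) <= 1.
    by rewrite mulr_ge0 ?subr_ge0 // mulr_ile1 ?subr_ge0 //; lra.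
  have : 0 <= alpha * (1 - r) <= 1.
    by rewrite mulr_ge0 ?subr_ge0 // mulr_ile1 ?subr_ge0 //; lra.
  set x := alpha * (1 - p); set z := alpha * (1 - r) => /andP[z0 z1] /andP[x0 x1].
  have -> : alpha * (1 + kappa^-1 - (p + r)) =
     x + z - alpha + alpha * kappa^-1 by rewrite /x /z; ring.
  have := mulr_ge0 x0 (_ : 0 <= 1 - z); have := mulr_ge0 z0 (_ : 0 <= 1 - x).
  rewrite !subr_ge0 => /(_ x1) H1 /(_ z1) H2; lra.
rewrite -(ler_pM2l k0) => /le_trans; apply.
by rewrite le_eqVlt; apply/orP; left; apply/eqP; field; rewrite gt_eqF.
Qed.

(** * Scaled matrices, the iterates and their error *)

Definition scaled (R : realType) (n : nat) (x : 'I_n -> R) (P : 'M[R]_n)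
    (y : 'I_n -> R) : 'M[R]_n :=
  \matrix_(i, j) (x i * P i j * y j).

Definition sk_error (R : realType) (n : nat) (W : 'M[R]_n) : R :=
  l1norm (row_sums W - const_mx 1) + l1norm (col_sums W - const_mx 1).

Lemma sk_errorE (R : realType) (n : nat) (W : 'M[R]_n) :
  sk_error W = \sum_i `|row_sum W i - 1| + \sum_j `|col_sum W j - 1|.
Proof. by congr (_ + _); apply: eq_bigr => i _; rewrite !mxE. Qed.

Lemma sk_error_tr (R : realType) (n : nat) (W : 'M[R]_n) :
  sk_error W^T = sk_error W.
Proof.
rewrite !sk_errorE addrC; congr (_ + _); apply: eq_bigr => i _;
  by congr (`|_ - 1|); apply: eq_bigr => j _; rewrite mxE.
Qed.

Lemma normalize_rows_tr (R : realType) (n : nat) (W : 'M[R]_n) :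
  normalize_rows W = (normalize_cols W^T)^T.
Proof.
by apply/matrixP => i j; rewrite !mxE; congr (_ / _); apply: eq_bigr => l _;
  rewrite mxE.
Qed.

(** The error sits in the columns before and in the rows after. The defect of row [i] is at most the
    sum over [j] of [W i j * |1 / c_j - 1|]; summing over [i] turns this into [|1 - c_j|]. This
    monotonicity extends a bound at one time to all later times. *)
Lemma sk_error_normalize_cols (R : realType) (n : nat) (W : 'M[R]_n) :
  nonneg_mx W -> (forall i, row_sum W i = 1) -> (forall j, 0 < col_sum W j) ->
  sk_error (normalize_cols W) <= sk_error W.
Proof.
move=> W0 W1 c0; rewrite !sk_errorE.
rewrite [X in _ + X <= _]big1 ?addr0; last first.
  move=> j _; apply/eqP; rewrite normr_eq0 subr_eq0.
  rewrite /col_sum; under eq_bigr => i _ do rewrite mxE.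
  by rewrite -mulr_suml divff // (gt_eqF (c0 j)).
rewrite [X in _ <= X + _]big1 ?add0r; last first.
  by move=> i _; rewrite W1 subrr normr0.
apply: le_trans (_ : \sum_i \sum_j W i j * `|(col_sum W j)^-1 - 1| <= _).
  apply: ler_sum => i _; rewrite -[X in `|_ - X|](W1 i) /row_sum -sumrB.
  apply: le_trans (ler_norm_sum _ _ _) _; apply: ler_sum => j _.
  by rewrite mxE -[X in _ - X]mulr1 -mulrBr normrM ger0_norm.
rewrite exchange_big; apply: ler_sum => j _.
rewrite -mulr_suml -/(col_sum W j) -[X in X * _](ger0_norm (ltW (c0 j))).
by rewrite -normrM mulrBr divff ?gt_eqF // mulr1 distrC.
Qed.

Lemma sk_error_normalize_rows (R : realType) (n : nat) (W : 'M[R]_n) :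
  nonneg_mx W -> (forall j, col_sum W j = 1) -> (forall i, 0 < row_sum W i) ->
  sk_error (normalize_rows W) <= sk_error W.
Proof.
move=> W0 W1 r0; rewrite normalize_rows_tr sk_error_tr -(sk_error_tr W).
apply: sk_error_normalize_cols => [i j|i|j]; first by rewrite mxE.
- by rewrite -[RHS](W1 i); apply: eq_bigr => j _; rewrite mxE.
- have -> : col_sum W^T j = row_sum W j by apply: eq_bigr => i _; rewrite mxE.
  by [].
Qed.

Lemma row_sum_scaled (R : realType) (n : nat) (x : 'I_n -> R) (P : 'M[R]_n)
    (y : 'I_n -> R) (i : 'I_n) :
  row_sum (scaled x P y) i = x i / rescale P y i.
Proof.
rewrite /rescale invrK mulr_sumr.
by apply: eq_bigr => j _; rewrite mxE mulrA.
Qed.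

Lemma col_sum_scaled (R : realType) (n : nat) (x : 'I_n -> R) (P : 'M[R]_n)
    (y : 'I_n -> R) (j : 'I_n) :
  col_sum (scaled x P y) j = y j / rescale P^T x j.
Proof.
rewrite /rescale invrK mulr_sumr.
by apply: eq_bigr => i _; rewrite !mxE; ring.
Qed.

Lemma normalize_rows_scaled (R : realType) (n : nat) (x : 'I_n -> R)
    (P : 'M[R]_n) (y : 'I_n -> R) :
  (forall i, 0 < x i) ->
  normalize_rows (scaled x P y) = scaled (rescale P y) P y.
Proof.
move=> x0; apply/matrixP => i j; rewrite !mxE row_sum_scaled invf_div.
by field; rewrite gt_eqF.
Qed.

Lemma normalize_cols_scaled (R : realType) (n : nat) (x : 'I_n -> R)
    (P : 'M[R]_n) (y : 'I_n -> R) :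
  (forall j, 0 < y j) ->
  normalize_cols (scaled x P y) = scaled x P (rescale P^T x).
Proof.
move=> y0; apply/matrixP => i j; rewrite !mxE col_sum_scaled invf_div.
by field; rewrite gt_eqF.
Qed.

Lemma nonneg_scaled (R : realType) (n : nat) (x : 'I_n -> R) (P : 'M[R]_n)
    (y : 'I_n -> R) :
  stochastic P -> (forall i, 0 < x i) -> (forall j, 0 < y j) ->
  nonneg_mx (scaled x P y).
Proof. by move=> [P0 _] x0 y0 i j; rewrite mxE !mulr_ge0 // ltW. Qed.

Section Iterates.
Variables (R : realType) (n : nat) (P : 'M[R]_n) (x y : 'I_n -> R).
Hypothesis biP : bistochastic P.
Hypotheses (x_gt0 : forall i, 0 < x i) (y_gt0 : forall j, 0 < y j).

Definition sk_step (z : 'I_n -> R) : 'I_n -> R := rescale P^T (rescale P z).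

Definition sk_scaling (k : nat) : 'I_n -> R := iter k sk_step y.

Lemma sk_scaling_gt0 k j : 0 < sk_scaling k j.
Proof.
case: biP => sP sPT; elim: k j => //= k IHk j.
by do 2!apply: rescale_gt0 => // ?.
Qed.

(** The initial row factor [x] disappears with the first normalization, so the column factor alone
    drives the process. *)
Lemma SK_even k :
  SK (scaled x P y) k.*2 = scaled (rescale P (sk_scaling k)) P (sk_scaling k).
Proof.
case: biP => sP sPT; elim: k => [|k IHk] /=; first exact: normalize_rows_scaled.
rewrite odd_double /= IHk normalize_cols_scaled ?normalize_rows_scaled //.
- by apply: rescale_gt0 => // j; exact: sk_scaling_gt0.
- exact: sk_scaling_gt0.
Qed.

Lemma SK_odd k :
  SK (scaled x P y) k.*2.+1 =
  scaled (rescale P (sk_scaling k)) P (sk_scaling k.+1).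
Proof.
by rewrite /= odd_double /= SK_even normalize_cols_scaled //; exact: sk_scaling_gt0.
Qed.

Lemma sk_error_step l :
  sk_error (SK (scaled x P y) l.+1) <= sk_error (SK (scaled x P y) l).
Proof.
case: (biP) => sP sPT.
have yk k := sk_scaling_gt0 k.
have xk k i : 0 < rescale P (sk_scaling k) i by apply: rescale_gt0.
rewrite /=; case: ifPn => [/negPf ol|/negPn ol];
  rewrite -(odd_double_half l) ol.
  rewrite add0n SK_even; apply: sk_error_normalize_cols.
  - exact: nonneg_scaled.
  - by move=> i; rewrite row_sum_scaled divff // gt_eqF.
  - by move=> j; rewrite col_sum_scaled divr_gt0 // (yk _.+1).
rewrite add1n SK_odd; apply: sk_error_normalize_rows.
- exact: nonneg_scaled.
- by move=> j; rewrite col_sum_scaled divff // gt_eqF // (yk _.+1).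
- by move=> i; rewrite row_sum_scaled divr_gt0.
Qed.

Lemma sk_error_nonincr k l :
  (k <= l)%N ->
  sk_error (SK (scaled x P y) l) <= sk_error (SK (scaled x P y) k).
Proof.
move/subnK <-; elim: (l - k)%N => // d IHd.
by rewrite addSn; exact: le_trans (sk_error_step _) IHd.
Qed.

(** At even times the row sums are exact. A column sum is [y j] times a mean of reciprocals of means
    of [y], hence lies in [[1 / kappa, kappa]], and [1 / kappa >= 2 - kappa]. *)
Lemma sk_error_spread k kappa :
  spread kappa (sk_scaling k) ->
  sk_error (SK (scaled x P y) k.*2) <= n%:R * (kappa - 1).
Proof.
case: (biP) => -[P0 P1] [PT0 PT1] [m m0 ym].
have yk := sk_scaling_gt0 k; rewrite SK_even sk_errorE.
rewrite big1 ?add0r; last first.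
  move=> i _; rewrite row_sum_scaled divff ?subrr ?normr0 // gt_eqF //.
  exact: rescale_gt0.
rewrite mulr_natl -[X in _ <= _ *+ X]card_ord -sumr_const; apply: ler_sum => j _.
have f0 i : 0 < \sum_l P i l * sk_scaling k l by apply: (@wmean_gt0 _ _ (P i)).
have /andP[yj1 yj2] := ym j.
have km0 : 0 < kappa * m by apply: lt_le_trans yj2.
have k0 : 0 < kappa by move: km0; rewrite pmulr_lgt0.
have k1 : 1 <= kappa by have := le_trans yj1 yj2; rewrite ler_pMl.
rewrite col_sum_scaled {1}/rescale invrK.
have lo : (kappa * m)^-1 <= \sum_i P^T j i * rescale P (sk_scaling k) i.
  apply: (@wmean_ge _ _ (P^T j)) => // i; rewrite lef_pV2 ?posrE //.
  by apply: (@wmean_le _ _ (P i)) => // l; case/andP: (ym l).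
have up : \sum_i P^T j i * rescale P (sk_scaling k) i <= m^-1.
  apply: (@wmean_le _ _ (P^T j)) => // i; rewrite lef_pV2 ?posrE //.
  by apply: (@wmean_ge _ _ (P i)) => // l; case/andP: (ym l).
set s := \sum_i _ in lo up *.
have s1 : kappa^-1 <= sk_scaling k j * s.
  have -> : kappa^-1 = m * (kappa * m)^-1 by field; rewrite !gt_eqF.
  by apply: ler_pM => //; rewrite ?ltW ?invr_gt0.
have s2 : sk_scaling k j * s <= kappa.
  have -> : kappa = (kappa * m) * m^-1 by field; rewrite !gt_eqF.
  apply: ler_pM => //; first exact: ltW.
  by apply: le_trans lo; rewrite ltW ?invr_gt0.
have s3 : 2 - kappa <= kappa^-1.
  rewrite -subr_ge0.
  have -> : kappa^-1 - (2 - kappa) = (kappa - 1) ^+ 2 / kappa.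
    by field; rewrite gt_eqF.
  by rewrite divr_ge0 ?sqr_ge0 // ltW.
by rewrite ler_norml; lra.
Qed.

End Iterates.

(** * Existence of the doubly stochastic scaling *)

(** Degrees are natural numbers, so that intersections of heavy sets are counted without rounding;
    the entries are at most 1 because [B] will be divided by its largest entry. *)
Definition graph_dense (R : realType) (n : nat) (g g' : nat) (rho : R)
    (B : 'M[R]_n) : Prop :=
  [/\ forall i j, 0 <= B i j <= 1,
      forall i, (g <= #|[set j | (rho <= B i j)%R]|)%N &
      forall j, (g' <= #|[set i | (rho <= B i j)%R]|)%N].

Lemma graph_dense_tr (R : realType) (n : nat) (g g' : nat) (rho : R)
    (B : 'M[R]_n) :
  graph_dense g g' rho B -> graph_dense g' g rho B^T.
Proof.
move=> [B01 Br Bc]; split=> [i j|i|j]; first by rewrite mxE.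
- apply: leq_trans (Bc i) _.
  by apply: subset_leq_card; apply/subsetP => j; rewrite !inE mxE.
- apply: leq_trans (Br j) _.
  by apply: subset_leq_card; apply/subsetP => i; rewrite !inE mxE.
Qed.

Lemma card_setI_ge (n s : nat) (S T : {set 'I_n}) :
  (n + s <= #|S| + #|T|)%N -> (s <= #|S :&: T|)%N.
Proof.
by have := cardsUI S T; have := max_card (S :|: T); rewrite card_ord; lia.
Qed.

(** Take [j0] with the largest value among the indices whose weak superlevel set has more than [L]
    elements. Were the strict superlevel set that large, its minimum would be a better choice. *)
Lemma quantile (R : realType) (n L : nat) (y : 'I_n -> R) :
  (L < n)%N ->
  exists j0, (L < #|[set j | (y j0 <= y j)%R]|)%N /\
             (#|[set j | (y j0 < y j)%R]| <= L)%N.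
Proof.
case: n y => // n y Ln.
pose U j0 := [set j | y j0 <= y j].
have [jm _ jmP] : exists2 jm : 'I_n.+1, true & forall j, y jm <= y j.
  by have [jm _ jmP] := Order.TotalTheory.arg_minP y (isT : predT (ord0 : 'I_n.+1));
    exists jm => // j; apply: jmP.
have UmT : (L < #|U jm|)%N.
  by rewrite (_ : U jm = setT) ?cardsT ?card_ord //; apply/setP => j; rewrite !inE jmP.
have [j0 j0U j0P] := Order.TotalTheory.arg_maxP y (UmT : (fun j => L < #|U j|)%N jm).
exists j0; split; first exact: j0U.
rewrite leqNgt; apply/negP => LV.
have [j1 j1V] : exists j1, j1 \in [set j | y j0 < y j].
  by apply/set0Pn; rewrite -card_gt0; lia.
have [j2 j2V j2P] := Order.TotalTheory.arg_minP y j1V.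
have /j0P : (L < #|U j2|)%N.
  apply: leq_trans LV _; apply: subset_leq_card; apply/subsetP => j jV.
  by rewrite inE; apply: j2P.
have : j2 \in [set j | y j0 < y j] by exact: j2V.
rewrite inE ltNge => /negP H1 H2; apply: H1; exact: H2.
Qed.

Lemma prod_if_const (R : realType) (n : nat) (A : {set 'I_n}) (a b : R) :
  \prod_i (if i \in A then a else b) = a ^+ #|A| * b ^+ (n - #|A|).
Proof.
rewrite (bigID (mem A)) /=; congr (_ * _).
  by rewrite -prodr_const; apply: eq_bigr => i ->.
have -> : (n - #|A| = #|[predC A]|)%N
  by have := cardC A; rewrite [RHS]card_ord; lia.
by rewrite -prodr_const; apply: eq_bigr => i /negPf ->.
Qed.

Lemma exp_exchange (R : realType) (n a b : nat) (z M : R) :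
  0 <= z <= M -> (a <= b <= n)%N ->
  M ^+ a * z ^+ (n - a) <= M ^+ b * z ^+ (n - b).
Proof.
move=> /andP[z0 zM] /andP[ab bn].
have -> : (n - a = (b - a) + (n - b))%N by lia.
have -> : M ^+ b = M ^+ a * M ^+ (b - a) by rewrite -exprD subnKC.
rewrite exprD -mulrA ler_wpM2l ?exprn_ge0 ?(le_trans z0) // ler_wpM2r ?exprn_ge0 //.
by rewrite lerXn2r ?nnegrE ?(le_trans z0).
Qed.

(** The inequality makes the capacity decrease; the equality case forces a minimizer to have unit
    column sums. *)
Lemma AGM_le1 (R : realType) (n : nat) (e : 'I_n -> R) :
  (0 < n)%N -> (forall i, 0 <= e i) -> \sum_i e i = n%:R ->
  \prod_i e i <= 1 ?= iff [forall i, e i == 1].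
Proof.
move=> n0 e0 es; have n0R : n%:R != 0 :> R by rewrite pnatr_eq0 -lt0n.
have := @leif_AGM R 'I_n predT e (fun i _ => e0 i).
rewrite /= es card_ord divff // expr1n => -[h1 h2]; split=> //.
rewrite h2; apply/idP/idP => [/'forall_implyP H|/forallP H].
  apply/forallP => i.
  have ei j : e j = e i.
    by have := H j isT => /'forall_implyP /(_ i isT) /eqP.
  move: es; under eq_bigr => j _ do rewrite ei.
  rewrite sumr_const card_ord -[LHS]mulr_natr => en.
  by apply/eqP; apply: (mulIf n0R); rewrite en mul1r.
apply/'forall_implyP => i _; apply/'forall_implyP => j _.
by rewrite (eqP (H i)) (eqP (H j)).
Qed.

(** The infimum of this ratio over positive [y] is Gurvits' capacity of the product of the linear
    forms given by the rows of [B]. *)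
Definition capacity (R : realType) (n : nat) (B : 'M[R]_n) (y : 'I_n -> R) : R :=
  (\prod_i \sum_j B i j * y j) / \prod_j y j.

Lemma capacityZ (R : realType) (n : nat) (B : 'M[R]_n) (y : 'I_n -> R) (s : R) :
  s != 0 -> capacity B (fun j => s * y j) = capacity B y.
Proof.
move=> s0; rewrite /capacity.
under eq_bigr => i _.
  under eq_bigr => j _ do rewrite mulrCA.
  rewrite -mulr_sumr; over.
rewrite !big_split /= !prodr_const !card_ord -mulf_div divff ?mul1r //.
by rewrite expf_neq0.
Qed.

(** Let [z] be the value of [y] with more than [n - g] entries at or above it and at most [n - g]
    (the set [U]) above it. Every row has a heavy entry where [y >= z], so its sum is at least
    [rho z]; the rows in [H], heavy in column [jM], reach [rho * y jM]. Since
    [|U| <= n - g < g' <= |H|], the numerator has at least one more factor [y jM] than the bound on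
    the product of the [y j], and this yields the ratio. *)
Lemma capacity_coercive (R : realType) (n g g' : nat) (rho : R) (B : 'M[R]_n)
    (y : 'I_n -> R) (jm jM : 'I_n) :
  0 <= rho -> graph_dense g g' rho B -> (n < g + g')%N ->
  (forall j, 0 < y j) -> (forall j, y jm <= y j <= y jM) ->
  rho ^+ n * y jM <= y jm * capacity B y.
Proof.
move=> rho0 [B01 Br Bc] ngg y0 yb.
have n0 : (0 < n)%N by have := ltn_ord jm; lia.
have gn : (g <= n)%N by have := leq_trans (Br jm) (max_card _); rewrite card_ord.
have gn' : (g' <= n)%N by have := leq_trans (Bc jm) (max_card _); rewrite card_ord.
have Ln : (n - g < n)%N by lia.
have [j0 [T1 T2]] := quantile y Ln.
set z := y j0 in T1 T2; set M := y jM.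
have z0 : 0 < z by exact: y0.
have M0 : 0 < M by exact: y0.
have zM : z <= M by case/andP: (yb j0).
set U := [set j | z < y j] in T2.
set H := [set i | rho <= B i jM].
have row_ge i k : rho <= B i k -> rho * y k <= \sum_j B i j * y j.
  move=> Bik; rewrite (bigD1 k) //=; apply: ler_wpDr.
    apply: sumr_ge0 => j _; rewrite mulr_ge0 ?(ltW (y0 j)) //.
    by case/andP: (B01 i j).
  by apply: ler_wpM2r => //; exact: ltW.
have prodf : rho ^+ n * (M ^+ #|H| * z ^+ (n - #|H|)) <=
    \prod_i \sum_j B i j * y j.
  rewrite -prod_if_const -[X in rho ^+ X]card_ord -prodr_const -big_split /=.
  apply: ler_prod => i _; apply/andP; split.
    by rewrite mulr_ge0 //; case: ifP; rewrite ltW.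
  case: ifPn => [|_]; first by rewrite inE => /row_ge.
  have /card_gt0P[k] : (0 < #|[set j | (rho <= B i j)%R] :&: [set j | (z <= y j)%R]|)%N.
    by apply: card_setI_ge; apply: leq_trans (leq_add (Br i) T1); lia.
  rewrite !inE => /andP[Bik zk]; apply: le_trans (row_ge i k Bik).
  by rewrite ler_wpM2l.
have prody : z * \prod_j y j <= y jm * (M ^+ #|U| * z ^+ (n - #|U|)).
  rewrite -prod_if_const (bigD1 jm) //= [X in _ <= _ * X](bigD1 jm) //=.
  have /negPf -> : jm \notin U by rewrite inE -leNgt; case/andP: (yb j0).
  rewrite !mulrA [z * y jm]mulrC; apply: ler_wpM2l; first by rewrite mulr_ge0 ?ltW.
  apply: ler_prod => j _; rewrite ltW //=.
  by case: ifPn; [case/andP: (yb j)|rewrite inE -leNgt].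
have Hn : (#|H| <= n)%N by have := max_card H; rewrite card_ord.
have UH : (#|U|.+1 <= #|H| <= n)%N.
  by rewrite Hn andbT; have := Bc jM; rewrite -/H; lia.
have zM' : 0 <= z <= M by rewrite ltW.
have ex := exp_exchange zM' UH.
have Py0 : 0 < \prod_j y j by apply: prodr_gt0.
rewrite /capacity mulrA ler_pdivlMr // -(ler_pM2l z0).
have -> : z * (rho ^+ n * M * \prod_j y j) = rho ^+ n * M * (z * \prod_j y j) by ring.
apply: le_trans (_ : rho ^+ n * M * (y jm * (M ^+ #|U| * z ^+ (n - #|U|))) <= _).
  by rewrite ler_wpM2l // mulr_ge0 ?exprn_ge0 // ltW.
have -> : z ^+ (n - #|U|) = z * z ^+ (n - #|U|.+1).
  by rewrite -exprS; congr (_ ^+ _); lia.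
have -> : rho ^+ n * M * (y jm * (M ^+ #|U| * (z * z ^+ (n - #|U|.+1)))) =
    z * y jm * (rho ^+ n * (M ^+ #|U|.+1 * z ^+ (n - #|U|.+1))).
  by rewrite exprS; ring.
rewrite [z * (y jm * _)]mulrA; apply: ler_wpM2l; first by rewrite mulr_ge0 ?ltW.
by apply: le_trans prodf; rewrite ler_wpM2l ?exprn_ge0.
Qed.

Lemma capacity_attained (R : realType) (n : nat) (B : 'M[R]_n) (r : R) :
  0 < r <= 1 ->
  exists2 y : 'I_n -> R, (forall j, r <= y j <= 1) &
    forall z, (forall j, r <= z j <= 1) -> capacity B y <= capacity B z.
Proof.
move=> /andP[r0 r1].
pose D : set 'rV[R]_n := [set v | forall j, `[r, 1]%classic (v ord0 j)]%classic.
have inD v : D v <-> forall j, r <= v ord0 j <= 1.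
  by split=> H j; have := H j; rewrite /= in_itv.
have cD : compact D.
  exact: (@rV_compact R n (fun=> `[r, 1]%classic) (fun=> @segment_compact R r 1)).
have D0 : (D !=set0)%classic.
  by exists (const_mx 1); apply/inD => j; rewrite mxE r1 lexx.
have ctsD : {within D, continuous (fun v : 'rV[R]_n => capacity B (v ord0))}%classic.
  apply: continuous_in_subspaceT => v /set_mem /inD vD.
  have fv : (\prod_i \sum_j B i j * t ord0 j @[t --> v] -->
      \prod_i \sum_j B i j * v ord0 j)%classic.
    apply: cvg_big; [exact: mul_continuous|move=> i _].
    apply: cvg_big; [exact: add_continuous|move=> j _].
    by apply: cvgM; [exact: cvg_cst|exact: coord_continuous].
  have yv : (\prod_j t ord0 j @[t --> v] --> \prod_j v ord0 j)%classic.
    by apply: cvg_big => [|j _]; [exact: mul_continuous|exact: coord_continuous].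
  suff y0 : \prod_j v ord0 j != 0 by exact: (cvgM fv (cvgV y0 yv)).
  apply/prodf_neq0 => j _; rewrite gt_eqF // (lt_le_trans r0) //.
  by case/andP: (vD j).
have [c cD' cmin] := EVT_min_rV D0 cD ctsD.
exists (c ord0) => [|z zD]; first by apply/(inD c); exact: set_mem cD'.
have := cmin (\row_j z j); rewrite (_ : capacity B ((\row_j z j) ord0) = capacity B z).
  by apply; apply/mem_set/inD => j; rewrite mxE.
rewrite /capacity; congr (_ / _).
  by apply: eq_bigr => i _; apply: eq_bigr => j _; rewrite mxE.
by apply: eq_bigr => j _; rewrite mxE.
Qed.

Lemma scaled_tr (R : realType) (n : nat) (a b : 'I_n -> R) (B : 'M[R]_n) :
  (scaled a B b)^T = scaled b B^T a.
Proof. by apply/matrixP => i j; rewrite !mxE; ring. Qed.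

(* A minimizer of the capacity is a fixed point of the Sinkhorn-Knopp step: by
   AM-GM each half step does not increase the capacity, strictly unless the
   column sums are already 1, and coercivity keeps the iterates in the box on
   which the minimum is taken. *)
Lemma exists_balancing (R : realType) (n g g' : nat) (rho : R) (B : 'M[R]_n) :
  (0 < n)%N -> 0 < rho -> graph_dense g g' rho B -> (n < g + g')%N ->
  exists a b : 'I_n -> R,
    [/\ forall i, 0 < a i, forall j, 0 < b j & bistochastic (scaled a B b)].
Proof.
case: n B => // n B _ rho0 dB ngg; have [B01 Br Bc] := dB.
pose i0 : 'I_n.+1 := ord0.
have B0 i j : 0 <= B i j by case/andP: (B01 i j).
have extrema (y : 'I_n.+1 -> R) : exists jm jM, forall j, y jm <= y j <= y jM.
  have [jm _ jmP] := Order.TotalTheory.arg_minP y (isT : predT i0).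
  have [jM _ jMP] := Order.TotalTheory.arg_maxP y (isT : predT i0).
  by exists jm, jM => j; apply/andP; split; [exact: jmP|exact: jMP].
have gn : (g <= n.+1)%N by have := leq_trans (Br i0) (max_card _); rewrite card_ord.
have gn' : (g' <= n.+1)%N by have := leq_trans (Bc i0) (max_card _); rewrite card_ord.
have rowpos (y : 'I_n.+1 -> R) i : (forall j, 0 < y j) -> 0 < \sum_j B i j * y j.
  move=> y0; have /card_gt0P[k] : (0 < #|[set j | (rho <= B i j)%R]|)%N.
    by apply: leq_trans (Br i); lia.
  rewrite inE => Bik; rewrite (bigD1 k) //=; apply: ltr_wpDr.
    by apply: sumr_ge0 => j _; rewrite mulr_ge0 // ltW.
  by rewrite mulr_gt0 // (lt_le_trans rho0).
have colpos (x : 'I_n.+1 -> R) j : (forall i, 0 < x i) -> 0 < \sum_i B i j * x i.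
  move=> x0; have /card_gt0P[k] : (0 < #|[set i | (rho <= B i j)%R]|)%N.
    by apply: leq_trans (Bc j); lia.
  rewrite inE => Bkj; rewrite (bigD1 k) //=; apply: ltr_wpDr.
    by apply: sumr_ge0 => i _; rewrite mulr_ge0 // ltW.
  by rewrite mulr_gt0 // (lt_le_trans rho0).
pose one (j : 'I_n.+1) : R := 1.
have rn0 : 0 < rho ^+ n.+1 by rewrite exprn_gt0.
(* Coercivity bounds [max y / min y] by [K] whenever the capacity of [y] is at most that of [one],
   so the box [[1 / K, 1]] suffices after rescaling. *)
pose K := capacity B one / rho ^+ n.+1.
have K1 : 1 <= K.
  rewrite ler_pdivlMr // mul1r.
  have := @capacity_coercive _ _ g g' rho B one i0 i0 (ltW rho0) dB ngg.
  by rewrite /one !mulr1 mul1r; apply=> j; rewrite ?lexx ?ltr01.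
have K0 : 0 < K by apply: lt_le_trans K1.
have [|y yD ymin] := @capacity_attained R n.+1 B K^-1.
  by rewrite invr_gt0 K0 invf_le1.
have y0 j : 0 < y j.
  by case/andP: (yD j) => + _; apply: lt_le_trans; rewrite invr_gt0.
pose f i := \sum_j B i j * y j.
have f0 i : 0 < f i by apply: rowpos.
pose h j := \sum_i B i j * (f i)^-1.
have h0 j : 0 < h j by apply: colpos => i; rewrite invr_gt0.
(* [z] is the column scaling after one more round. Below, [y j * h j] are the column sums of a
   row-normalized matrix and [f' i / f i] the row sums of a column-normalized one, so both families
   sum to the dimension and AM-GM applies. *)
pose z j := (h j)^-1.
have z0 j : 0 < z j by rewrite invr_gt0.
pose f' i := \sum_j B i j * z j.
have f'0 i : 0 < f' i by apply: rowpos.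
have sum_c : \sum_j y j * h j = n.+1%:R.
  under eq_bigr => j _ do rewrite mulr_sumr.
  rewrite exchange_big /= -[X in X%:R]card_ord -sumr_const.
  apply: eq_bigr => i _; rewrite -[RHS](divff (lt0r_neq0 (f0 i))) {2}/f mulr_suml.
  by apply: eq_bigr => j _; ring.
have sum_r : \sum_i f' i / f i = n.+1%:R.
  under eq_bigr => i _ do rewrite mulr_suml.
  rewrite exchange_big /= -[X in X%:R]card_ord -sumr_const.
  apply: eq_bigr => j _; rewrite -[RHS](divff (lt0r_neq0 (h0 j))) {1}/h mulr_suml.
  by apply: eq_bigr => i _; rewrite /z; ring.
have [prod_r _] := @AGM_le1 R n.+1 (fun i => f' i / f i) isT
  (fun i => ltW (divr_gt0 (f'0 i) (f0 i))) sum_r.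
have [prod_c prod_c1] := @AGM_le1 R n.+1 (fun j => y j * h j) isT
  (fun j => ltW (mulr_gt0 (y0 j) (h0 j))) sum_c.
have Pf0 : 0 < \prod_i f i by apply: prodr_gt0.
have Py0 : 0 < \prod_j y j by apply: prodr_gt0.
have cap_z : capacity B z <= capacity B y * \prod_j (y j * h j).
  rewrite /capacity -/f big_split /=.
  have -> : \prod_j z j = (\prod_j h j)^-1 by rewrite prodfV.
  rewrite invrK mulrA divfK ?gt_eqF //.
  apply: ler_wpM2r; first by apply: prodr_ge0 => j _; exact: ltW.
  by move: prod_r; rewrite big_split /= prodfV ler_pdivrMr // mul1r; apply.
have cy0 : 0 < capacity B y by rewrite divr_gt0.
have cap_y1 : capacity B y <= capacity B one.
  by apply: ymin => j; rewrite /one lexx andbT invf_le1.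
(* The capacity of [z] is at most that of [one]; by coercivity, [z] divided by its maximum lies in
   the box and competes with the minimizer [y]. *)
have [jm [jM zb]] := extrema z.
have cap_yz : capacity B y <= capacity B z.
  rewrite -(@capacityZ _ _ B z (z jM)^-1) ?gt_eqF ?invr_gt0 //.
  apply: ymin => j; rewrite mulrC.
  have /andP[zj1 zj2] := zb j.
  rewrite [X in _ && X]ler_pdivrMr // mul1r zj2 andbT.
  rewrite ler_pdivlMr // ler_pdivrMl //.
  apply: le_trans (_ : K * z jm <= _); last by rewrite ler_pM2l.
  rewrite /K mulrAC ler_pdivlMr // mulrC.
  apply: le_trans (capacity_coercive (ltW rho0) dB ngg z0 zb) _.
  rewrite mulrC ler_pM2r //; apply: le_trans cap_z _; apply: le_trans cap_y1.
  by rewrite -[leRHS]mulr1 ler_pM2l.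
have c1 j : y j * h j = 1.
  apply/eqP; move: j; apply/forallP; rewrite -prod_c1 eq_le prod_c /=.
  by rewrite -(ler_pM2l cy0) mulr1; apply: le_trans cap_z.
exists (fun i => (f i)^-1), y; split=> [i|//|]; first by rewrite invr_gt0.
split; split=> [i j|i].
- by rewrite mxE !mulr_ge0 ?invr_ge0 // ltW.
- under eq_bigr => j _ do rewrite mxE -mulrA.
  by rewrite -mulr_sumr mulVf // gt_eqF.
- by rewrite !mxE !mulr_ge0 ?invr_ge0 // ltW.
- rewrite -[RHS](c1 i) mulr_sumr; apply: eq_bigr => j _.
  by rewrite !mxE; ring.
Qed.

(** * Quantitative bounds on the doubly stochastic scaling *)

Section Balanced.
Variables (R : realType) (n g g' : nat) (rho : R) (B : 'M[R]_n).
Variables a b : 'I_n -> R.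
Hypotheses (rho_gt0 : 0 < rho) (dB : graph_dense g g' rho B).
Hypotheses (ngg : (n < g + g')%N) (n_gt0 : (0 < n)%N).
Hypotheses (a_gt0 : forall i, 0 < a i) (b_gt0 : forall j, 0 < b j).
Hypothesis biP : bistochastic (scaled a B b).

Let d := (g + g' - n)%N.
(** [n] times the upper bound on [a i * b j]; it depends on [d] and [n] only through [d / n]. *)
Let K : R := 27 * n%:R ^+ 3 / (rho ^+ 2 * d%:R ^+ 3).

Let n0 : 0 < n%:R :> R. Proof. by rewrite ltr0n. Qed.
Let d0 : 0 < d%:R :> R. Proof. by rewrite ltr0n /d; lia. Qed.

Lemma balanced_row i : \sum_j a i * B i j * b j = 1.
Proof. by case: biP => [[_ /(_ i) <-] _]; apply: eq_bigr => j _; rewrite mxE. Qed.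

Lemma balanced_col j : \sum_i a i * B i j * b j = 1.
Proof. by case: biP => [_ [_ /(_ j) <-]]; apply: eq_bigr => i _; rewrite !mxE. Qed.

Let P0 i j : 0 <= a i * B i j * b j.
Proof. by case: biP => [[/(_ i j) + _] _]; rewrite mxE. Qed.

Let i0 : 'I_n := Ordinal n_gt0.

Let gn : (g <= n)%N.
Proof.
by case: dB => _ Br _; have := leq_trans (Br i0) (max_card _); rewrite card_ord.
Qed.

Let gn' : (g' <= n)%N.
Proof.
by case: dB => _ _ Bc; have := leq_trans (Bc i0) (max_card _); rewrite card_ord.
Qed.

(** The rows of [X] carry mass [|X|], of which at most [n - |Y|] fits in the columns outside [Y]. *)
Lemma balanced_rectangle (X Y : {set 'I_n}) :
  #|X|%:R + #|Y|%:R - n%:R <=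
  \sum_(i in X) \sum_(j in Y) a i * B i j * b j.
Proof.
have HX : \sum_(i in X) \sum_j a i * B i j * b j = #|X|%:R.
  by under eq_bigr => i _ do rewrite balanced_row; rewrite sumr_const.
have HY : \sum_(j in ~: Y) \sum_i a i * B i j * b j = n%:R - #|Y|%:R.
  under eq_bigr => j _ do rewrite balanced_col.
  rewrite sumr_const; apply/eqP; rewrite -[n in n%:R]card_ord eq_sym subr_eq.
  by rewrite -natrD addnC cardsC.
have : \sum_(i in X) \sum_(j in ~: Y) a i * B i j * b j <=
    \sum_(j in ~: Y) \sum_i a i * B i j * b j.
  rewrite exchange_big /=; apply: ler_sum => j _.
  by rewrite [leRHS](bigID (mem X)) /= ler_wpDr // sumr_ge0.
rewrite HY -HX => le.
have -> : \sum_(i in X) \sum_j a i * B i j * b j =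
    \sum_(i in X) \sum_(j in Y) a i * B i j * b j +
    \sum_(i in X) \sum_(j in ~: Y) a i * B i j * b j.
  rewrite -big_split /=; apply: eq_bigr => i _.
  rewrite (bigID (mem Y)) /=; congr (_ + _).
  by apply: eq_bigl => j; rewrite inE.
move: le; set s := \sum_(i in X) _; set t := \sum_(i in X) _; lra.
Qed.

(* With [d] the excess [g + g' - n] and [s] about [d / 3], let [bs] (resp.
   [as_]) be the threshold exceeded by all but about [g - s] of the [b j] (resp.
   [g' - s] of the [a i]). Every row has [s] heavy entries whose column factor is
   at least [bs], so [a i <= 1 / (rho s bs)], and symmetrically for [b j]. The
   rectangle of the small factors still has mass at least [d / 3], which bounds
   [as_ * bs] from below. *)
Lemma balanced_factor_le i j : a i * b j * (rho ^+ 2 * d%:R ^+ 3) <= 27 * n%:R ^+ 2.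
Proof.
case: (dB) => B01 Br Bc.
(* Rounding is chosen so that both [s] and [d + 2 - 2 s] are at least [d / 3]; the latter is the
   guaranteed excess [|X| + |Y| - n] of the rectangle. *)
pose s := (d %/ 3).+1.
have sd : (s <= d)%N by rewrite /s /d; lia.
have s3 : (d <= 3 * s)%N by rewrite /s; lia.
have s2 : (d <= 3 * (d + 2 - 2 * s))%N by rewrite /s; lia.
have s1 : (0 < s)%N by [].
have dg : (d <= g)%N by rewrite /d; lia.
have dg' : (d <= g')%N by rewrite /d; lia.
have L1 : (n - g + s - 1 < n)%N by lia.
have L2 : (n - g' + s - 1 < n)%N by lia.
have [jb [T1 T2]] := quantile b L1.
have [ia [S1 S2]] := quantile a L2.
set bs := b jb in T1 T2; set as_ := a ia in S1 S2.
have bs0 : 0 < bs by exact: b_gt0.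
have as0 : 0 < as_ by exact: a_gt0.
have amax : a i * (rho * s%:R * bs) <= 1.
  set T := [set j | (bs <= b j)%R] in T1.
  set N := [set j | (rho <= B i j)%R].
  have NT : (s <= #|N :&: T|)%N.
    by apply: card_setI_ge; apply: leq_trans (leq_add (Br i) T1); lia.
  rewrite -[leRHS](balanced_row i) [leRHS](bigID (mem (N :&: T))) /= ler_wpDr ?sumr_ge0 //.
  apply: le_trans (_ : \sum_(j in N :&: T) a i * rho * bs <= _).
    rewrite sumr_const -[leRHS]mulr_natr.
    have -> : a i * (rho * s%:R * bs) = a i * rho * bs * s%:R by ring.
    by rewrite ler_wpM2l ?ler_nat // !mulr_ge0 // ltW.
  apply: ler_sum => l; rewrite !inE => /andP[Bl bl].
  by rewrite -!mulrA ler_pM2l // ler_pM // ltW.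
have bmax : b j * (rho * s%:R * as_) <= 1.
  set T := [set i | (as_ <= a i)%R] in S1.
  set N := [set i | (rho <= B i j)%R].
  have NT : (s <= #|N :&: T|)%N.
    by apply: card_setI_ge; apply: leq_trans (leq_add (Bc j) S1); lia.
  rewrite -[leRHS](balanced_col j) [leRHS](bigID (mem (N :&: T))) /= ler_wpDr ?sumr_ge0 //.
  apply: le_trans (_ : \sum_(i in N :&: T) as_ * rho * b j <= _).
    rewrite sumr_const -[leRHS]mulr_natr.
    have -> : b j * (rho * s%:R * as_) = as_ * rho * b j * s%:R by ring.
    by rewrite ler_wpM2l ?ler_nat // !mulr_ge0 // ltW.
  apply: ler_sum => l; rewrite !inE => /andP[Bl bl].
  by rewrite ler_pM2r // ler_pM // ltW.
set Y := [set j | (b j <= bs)%R]; set X := [set i | (a i <= as_)%R].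
have cY : (g + 1 <= #|Y| + s)%N.
  have YC : [set j | (bs < b j)%R] = ~: Y by apply/setP => l; rewrite !inE ltNge.
  by move: T2; rewrite YC; have := cardsC Y; rewrite card_ord; lia.
have cX : (g' + 1 <= #|X| + s)%N.
  have XC : [set i | (as_ < a i)%R] = ~: X by apply/setP => l; rewrite !inE ltNge.
  by move: S2; rewrite XC; have := cardsC X; rewrite card_ord; lia.
have XY : d%:R <= 3 * (#|X|%:R + #|Y|%:R - n%:R) :> R.
  have : (d + 3 * n <= 3 * (#|X| + #|Y|))%N by move: s2; rewrite /d; lia.
  by rewrite -(ler_nat R) natrD !natrM natrD; lra.
have rect : #|X|%:R + #|Y|%:R - n%:R <= n%:R ^+ 2 * (as_ * bs).
  apply: le_trans (balanced_rectangle X Y) _.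
  apply: le_trans (_ : \sum_(i in X) \sum_(j in Y) as_ * bs <= _).
    apply: ler_sum => k kX; apply: ler_sum => l lY; move: kX lY; rewrite !inE => ka lb.
    have /andP[Bkl0 Bkl1] := B01 k l.
    apply: ler_pM => //; [by rewrite mulr_ge0 // ltW|exact: ltW|].
    by rewrite -[leRHS]mulr1 ler_pM // ltW.
  rewrite !sumr_const -mulrnA -[leLHS]mulr_natl.
  apply: ler_wpM2r; first by rewrite mulr_ge0 // ltW.
  rewrite natrM expr2 ler_pM // ler_nat.
    by have := max_card Y; rewrite card_ord.
  by have := max_card X; rewrite card_ord.
have AB : d%:R <= 3 * n%:R ^+ 2 * (as_ * bs).
  by move: (n%:R ^+ 2 * (as_ * bs)) rect (mulrA 3 (n%:R ^+ 2 : R) (as_ * bs)) => z zl <-; lra.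
have ab1 : a i * b j * (rho ^+ 2 * s%:R ^+ 2) * (as_ * bs) <= 1.
  have -> : a i * b j * (rho ^+ 2 * s%:R ^+ 2) * (as_ * bs) =
     (a i * (rho * s%:R * bs)) * (b j * (rho * s%:R * as_)) by ring.
  by rewrite mulr_ile1 // !mulr_ge0 // ltW.
have s0 : 0 < s%:R :> R by rewrite ltr0n.
have ds : d%:R <= 3 * s%:R :> R by rewrite -natrM ler_nat.
have c0 : 0 <= a i * b j * rho ^+ 2 by rewrite !mulr_ge0 ?exprn_ge0 ?ltW.
have d9 : d%:R ^+ 2 <= 9 * s%:R ^+ 2 :> R.
  have -> : 9 * s%:R ^+ 2 = (3 * s%:R) ^+ 2 :> R by ring.
  by apply: lerXn2r; rewrite ?nnegrE ?mulr_ge0.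
have -> : a i * b j * (rho ^+ 2 * d%:R ^+ 3) = a i * b j * rho ^+ 2 * (d%:R ^+ 2 * d%:R).
  by ring.
apply: le_trans (_ : a i * b j * rho ^+ 2 * (9 * s%:R ^+ 2 * (3 * n%:R ^+ 2 * (as_ * bs))) <= _).
  by rewrite ler_wpM2l // ler_pM // ?exprn_ge0 ?(ltW d0).
have -> : a i * b j * rho ^+ 2 * (9 * s%:R ^+ 2 * (3 * n%:R ^+ 2 * (as_ * bs))) =
    27 * n%:R ^+ 2 * (a i * b j * (rho ^+ 2 * s%:R ^+ 2) * (as_ * bs)) by ring.
by rewrite -[leRHS]mulr1 ler_wpM2l // mulr_ge0 ?exprn_ge0 ?ltW.
Qed.

Lemma balanced_const_gt0 : 0 < K.
Proof. by rewrite divr_gt0 ?mulr_gt0 ?exprn_gt0. Qed.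

Let factor_le i j : a i * b j <= K / n%:R.
Proof.
have -> : K / n%:R = 27 * n%:R ^+ 2 / (rho ^+ 2 * d%:R ^+ 3).
  by rewrite /K; field; rewrite !gt_eqF.
by rewrite ler_pdivlMr ?mulr_gt0 ?exprn_gt0 //; exact: balanced_factor_le.
Qed.

Let Sa := \sum_i a i.
Let Sb := \sum_j b j.

Let Sa_gt0 : 0 < Sa.
Proof.
by rewrite /Sa (bigD1 i0) //= ltr_wpDr // sumr_ge0 // => i _; rewrite ltW.
Qed.

Let Sb_gt0 : 0 < Sb.
Proof.
by rewrite /Sb (bigD1 i0) //= ltr_wpDr // sumr_ge0 // => i _; rewrite ltW.
Qed.

Let bSa j : 1 <= b j * Sa.
Proof.
rewrite -[leLHS](balanced_col j) mulrC mulr_suml; apply: ler_sum => i _.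
rewrite ler_pM2r // -[leRHS]mulr1 ler_pM2l //.
by case: dB => /(_ i j) /andP[].
Qed.

Let aSb i : 1 <= a i * Sb.
Proof.
rewrite -[leLHS](balanced_row i) mulr_sumr; apply: ler_sum => j _.
rewrite ler_pM2r // -[leRHS]mulr1 ler_pM2l //.
by case: dB => /(_ i j) /andP[].
Qed.

(** As entries are at most 1, a unit column sum gives [1 <= b j * Sa]. Multiplying by [b l] leaves
    [n] products [a i * b l], each at most [K / n]. *)
Lemma balanced_ratio j l : b l <= K * b j.
Proof.
apply: le_trans (_ : b l * (b j * Sa) <= _); first by rewrite -[leLHS]mulr1 ler_pM2l.
have -> : b l * (b j * Sa) = b j * \sum_i a i * b l.
  by rewrite -mulr_suml -/Sa; ring.
rewrite mulrC ler_pM2r //.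
have -> : K = \sum_(i < n) K / n%:R.
  by rewrite sumr_const card_ord -[RHS]mulr_natr divfK // gt_eqF.
by apply: ler_sum.
Qed.

Let SaSb : Sa * Sb <= K * n%:R.
Proof.
have -> : K * n%:R = \sum_(i < n) \sum_(j < n) K / n%:R.
  rewrite !sumr_const card_ord -mulrnA -[RHS]mulr_natr natrM.
  by field; rewrite gt_eqF.
rewrite /Sa mulr_suml; apply: ler_sum => i _; rewrite mulr_sumr.
by apply: ler_sum => j _.
Qed.

(** The converse of [factor_le]: multiply [1 <= a i * Sb] by [1 <= b j * Sa] and bound [Sa * Sb] by
    its [n^2] products. *)
Let factor_ge i j : 1 <= a i * b j * (K * n%:R).
Proof.
apply: le_trans (_ : (a i * Sb) * (b j * Sa) <= _); first by rewrite mulr_ege1.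
have -> : a i * Sb * (b j * Sa) = a i * b j * (Sa * Sb) by ring.
by rewrite ler_pM2l // mulr_gt0.
Qed.

Lemma balanced_entry_ge i j :
  rho <= B i j -> rho / (K * n%:R) <= scaled a B b i j.
Proof.
move=> Bij; rewrite mxE ler_pdivrMr ?(mulr_gt0 balanced_const_gt0 n0) //.
have -> : a i * B i j * b j * (K * n%:R) = B i j * (a i * b j * (K * n%:R)) by ring.
by rewrite -[leLHS]mulr1 ler_pM // ltW.
Qed.

(* Columns of degree at least [g' >= n / 2] share heavy rows; keeping the weight
   [b l / Sb] instead of its worst value saves a factor of order [K]. *)
Lemma balanced_doeblin :
  (g <= g')%N ->
  exists w : 'I_n -> R, [/\ forall l, 0 <= w l, \sum_l w l = 1 &
    forall j l, rho ^+ 2 * d%:R / (K * n%:R) * w l <=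
      \sum_i scaled a B b i j * scaled a B b i l].
Proof.
move=> gg; exists (fun l => b l / Sb); split=> [l||j l].
- by rewrite divr_ge0 // ltW.
- by rewrite -mulr_suml divff // gt_eqF.
case: (dB) => B01 Br Bc.
set N := [set i | (rho <= B i j)%R] :&: [set i | (rho <= B i l)%R].
have dN : (d <= #|N|)%N.
  by apply: card_setI_ge; apply: leq_trans (leq_add (Bc j) (Bc l)); rewrite /d; lia.
have Kn0 := mulr_gt0 balanced_const_gt0 n0.
rewrite (bigID (mem N)) /= ler_wpDr ?sumr_ge0 // => [i _|].
  by rewrite !mxE mulr_ge0.
(* On a common heavy row, [P i j] gets its worst-case bound, while [P i l >= rho * a i * b l >= rho
   * b l / Sb] keeps its dependence on [l]. *)
apply: le_trans (_ : \sum_(i in N) rho / (K * n%:R) * (rho * (b l / Sb)) <= _).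
  rewrite sumr_const -[leRHS]mulr_natr.
  have -> : rho ^+ 2 * d%:R / (K * n%:R) * (b l / Sb) =
     rho / (K * n%:R) * (rho * (b l / Sb)) * d%:R by ring.
  rewrite ler_wpM2l ?ler_nat // mulr_ge0 // ltW //.
    by rewrite divr_gt0.
  by rewrite mulr_gt0 // divr_gt0.
apply: ler_sum => i; rewrite !inE => /andP[Bij Bil].
apply: ler_pM; rewrite ?balanced_entry_ge //.
- by rewrite divr_ge0 ?(ltW Kn0) ?(ltW rho_gt0).
- by rewrite mulr_ge0 ?divr_ge0 ?(ltW rho_gt0) ?(ltW Sb_gt0) ?(ltW (b_gt0 l)).
rewrite mxE mulrA ler_pdivrMr //.
have -> : a i * B i l * b l * Sb = B i l * b l * (a i * Sb) by ring.
by rewrite -[leLHS]mulr1 ler_pM ?ler_pM2r // mulr_ge0 // ltW.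
Qed.

End Balanced.

(** * Geometric decay and the first round *)

Lemma spread_le (R : realType) (n : nat) (kappa kappa' : R) (y : 'I_n -> R) :
  kappa <= kappa' -> spread kappa y -> spread kappa' y.
Proof.
move=> kk [m m0 ym]; exists m => // j; have /andP[-> /= yj] := ym j.
by apply: le_trans yj _; rewrite ler_pM2r.
Qed.

Lemma bistochastic_tr (R : realType) (n : nat) (P : 'M[R]_n) :
  bistochastic P -> bistochastic P^T.
Proof. by case=> sP sPT; split; rewrite ?trmxK. Qed.

Definition doeblin (R : realType) (n : nat) (alpha : R) (P : 'M[R]_n) : Prop :=
  exists w : 'I_n -> R, [/\ forall l, 0 <= w l, \sum_l w l = 1 &
    forall j l, alpha * w l <= \sum_i P i j * P i l].

Lemma doeblin_le (R : realType) (n : nat) (alpha alpha' : R) (P : 'M[R]_n) :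
  alpha' <= alpha -> doeblin alpha P -> doeblin alpha' P.
Proof.
move=> aa [w [w0 w1 Pw]]; exists w; split=> // j l.
by apply: le_trans (Pw j l); rewrite ler_wpM2r.
Qed.

(* When only [P P^T] is minorized, it is the row scaling that contracts, one
   half step later. *)
Lemma sk_step2_contract (R : realType) (n : nat) (P : 'M[R]_n) (alpha kappa : R)
    (y : 'I_n -> R) :
  bistochastic P -> 0 <= alpha <= 1 -> doeblin alpha P \/ doeblin alpha P^T ->
  1 <= kappa -> spread kappa y ->
  spread (1 + (1 - alpha / 2) * (kappa - 1)) (sk_step P (sk_step P y)).
Proof.
move=> biP a01 doe k1 sy; have [sP sPT] := biP; have biPT := bistochastic_tr biP.
have k0 : 0 < kappa by apply: lt_le_trans k1.
have k0' : 0 < 1 + (1 - alpha / 2) * (kappa - 1).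
  by apply: ltr_wpDr => //; rewrite mulr_ge0 ?subr_ge0 //; case/andP: a01; lra.
case: doe => -[w [w0 w1 Pw]].
  by do 2!(apply: spread_rescale => //); apply: (spread_contract _ _ w0 w1 Pw).
apply: spread_rescale => //.
have := @spread_contract _ _ P^T w alpha kappa (rescale P y) biPT a01 w0 w1 Pw k1.
by rewrite trmxK; apply; exact: spread_rescale.
Qed.

Lemma sk_scaling_contract (R : realType) (n : nat) (P : 'M[R]_n) (alpha kappa : R)
    (y : 'I_n -> R) (m : nat) :
  bistochastic P -> 0 <= alpha <= 1 -> doeblin alpha P \/ doeblin alpha P^T ->
  1 <= kappa -> spread kappa y ->
  spread (1 + (1 - alpha / 2) ^+ m * (kappa - 1)) (sk_scaling P y m.*2).
Proof.
move=> biP a01 doe k1 sy; elim: m => [|m IHm].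
  by rewrite expr0 mul1r addrC subrK.
have q0 : 0 <= 1 - alpha / 2 by case/andP: a01; lra.
rewrite exprS -mulrA -[X in _ * X](addrK 1) [_ + 1]addrC.
rewrite doubleS /sk_scaling !iterS.
apply: sk_step2_contract => //.
by rewrite lerDl; apply: mulr_ge0; [exact: exprn_ge0|rewrite subr_ge0].
Qed.

(* The initial scaling may have a spread of order [n], which would cost a
   factor [log n]; a single step brings it down to a bound free of [n]. *)
Lemma spread_sk_step_start (R : realType) (n g g' d : nat) (P : 'M[R]_n)
    (E : 'I_n -> 'I_n -> bool) (beta H : R) (y : 'I_n -> R) :
  (0 < n)%N -> bistochastic P ->
  (0 < d)%N -> (n + d <= g + g')%N ->
  (forall i, (g <= #|[set j | E i j]|)%N) ->
  (forall j, (g' <= #|[set i | E i j]|)%N) ->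
  0 < beta <= 1 -> (forall i j, E i j -> beta / n%:R <= P i j) ->
  (forall j, 0 < y j) -> 0 < H ->
  (forall i j, E i j -> \sum_l P i l * y l <= H * y j) ->
  spread (H * (n%:R / (beta * d%:R)) ^+ 2) (sk_step P y).
Proof.
case: n P E y => // n P E y _ biP d_gt0 ngg Er Ec /andP[b0 b1] PE y0 H0 yE.
have [[P0 P1] sPT] := biP; have [PT0 PT1] := sPT.
have n0 : 0 < n.+1%:R :> R by [].
have d0 : 0 < d%:R :> R by rewrite ltr0n.
have gn : (g <= n.+1)%N by have := leq_trans (Er ord0) (max_card _); rewrite card_ord.
have gn' : (g' <= n.+1)%N by have := leq_trans (Ec ord0) (max_card _); rewrite card_ord.
pose f i := \sum_l P i l * y l.
have f0 i : 0 < f i by apply: (@wmean_gt0 _ _ (P i)).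
have [im _ imP] := Order.TotalTheory.arg_minP f (isT : predT (ord0 : 'I_n.+1)).
have fm i : f im <= f i by apply: imP.
(* [1 / q] is a lower bound for the mass of [d] heavy entries in a row or column of [P]. *)
set q := n.+1%:R / (beta * d%:R).
have q0 : 0 < q by rewrite divr_gt0 ?mulr_gt0.
have qE : q^-1 = beta / n.+1%:R * d%:R.
  by rewrite /q invf_div mulrAC.
have q1 : 1 <= q.
  rewrite -invf_le1 // qE mulrAC ler_pdivrMr // mul1r -[leRHS]mul1r.
  by rewrite ler_pM ?ler_nat ?(ltW b0) ?ler0n //; lia.
clearbody q.
have heavy_sum (F z : 'I_n.+1 -> R) (c : R) (S : {set 'I_n.+1}) :
    (d <= #|S|)%N -> 0 <= c -> (forall l, 0 <= F l) -> (forall l, 0 <= z l) ->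
    (forall l, l \in S -> beta / n.+1%:R <= F l) ->
    (forall l, l \in S -> c <= z l) -> c / q <= \sum_l F l * z l.
  move=> dS c0 F0 z0 FS zS.
  rewrite [leRHS](bigID (mem S)) /=; apply: ler_wpDr.
    by apply: sumr_ge0 => l _; rewrite mulr_ge0.
  apply: le_trans (_ : \sum_(l in S) beta / n.+1%:R * c <= _).
    rewrite sumr_const -[leRHS]mulr_natr qE.
    have -> : c * (beta / n.+1%:R * d%:R) = beta / n.+1%:R * c * d%:R by ring.
    by rewrite ler_wpM2l ?ler_nat // mulr_ge0 // divr_ge0 ?ltW.
  apply: ler_sum => l lS; apply: ler_pM; rewrite ?FS ?zS //.
  by rewrite divr_ge0 ?ltW.
have [gg|gg] := leqP g g'.
- exists (f im) => // j.
  have hE : sk_step P y j = (\sum_i P^T j i * (f i)^-1)^-1 by [].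
  have h0 : 0 < \sum_i P^T j i * (f i)^-1.
    by apply: (@wmean_gt0 _ _ (P^T j)) => // i; rewrite invr_gt0.
  apply/andP; split.
    rewrite hE -[leLHS]invrK lef_pV2 ?posrE ?invr_gt0 //.
    by apply: (@wmean_le _ _ (P^T j)) => // i; rewrite lef_pV2 ?posrE.
  set yj := sk_step P y j.
  have yj0 : 0 < yj by rewrite /yj hE invr_gt0.
  (* Columns [j] and [l] share [d] heavy rows, on which [f <= H * y l]; this bounds the new value
     [yj] by [H q * y l]. Averaging over the heavy [l] of row [im] then compares [yj] with the
     minimum of [f], at the cost of a second [q]. *)
  have key l : E im l -> yj / (H * q) <= y l.
    move=> _.
    have : (H * y l)^-1 / q <= \sum_i P^T j i * (f i)^-1.
      apply: (heavy_sum _ _ _ ([set i | E i j] :&: [set i | E i l])).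
      - by apply: card_setI_ge; apply: leq_trans (leq_add (Ec j) (Ec l)); lia.
      - by rewrite invr_ge0 mulr_ge0 // ltW.
      - by [].
      - by move=> i; rewrite invr_ge0 ltW.
      - by move=> i; rewrite !inE mxE => /andP[/PE].
      - move=> i; rewrite !inE => /andP[_ /yE fi].
        by rewrite lef_pV2 ?posrE ?mulr_gt0.
    rewrite -[leRHS]invrK -hE -/yj -invfM lef_pV2 ?posrE ?mulr_gt0 // => le.
    by rewrite ler_pdivrMr ?mulr_gt0 //; apply: le_trans le _; rewrite mulrCA mulrA.
  have : yj / (H * q) / q <= f im.
    apply: (heavy_sum _ _ _ [set l | E im l]) => //.
    - by apply: leq_trans (Er im); lia.
    - by rewrite divr_ge0 ?mulr_ge0 // ltW.
    - by move=> l; rewrite ltW.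
    - by move=> l; rewrite inE => /PE.
    - by move=> l; rewrite inE => /key.
  rewrite -mulrA -invfM ler_pdivrMr ?mulr_gt0 // => le.
  by apply: le_trans le _; rewrite mulrC expr2 mulrA.
(* Here it is two rows that share [d] heavy columns, so [f] already has spread [H q], and the second
   half step preserves it. *)
- have k0 : 0 < H * q ^+ 2 by rewrite mulr_gt0 // exprn_gt0.
  apply: spread_rescale => //; apply: (@spread_le _ _ (H * q)).
    by rewrite ler_pM2l // expr2 ler_pMr.
  exists (H * q * f im)^-1 => [|i]; first by rewrite invr_gt0 !mulr_gt0.
  have fi : f i <= H * q * f im.
    have : f i / H / q <= f im.
      apply: (heavy_sum _ _ _ ([set l | E im l] :&: [set l | E i l])) => //.
      - by apply: card_setI_ge; apply: leq_trans (leq_add (Er im) (Er i)); lia.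
      - by rewrite divr_ge0 // ltW.
      - by move=> l; rewrite ltW.
      - by move=> l; rewrite !inE => /andP[/PE].
      - by move=> l; rewrite !inE => /andP[_ /yE le]; rewrite ler_pdivrMr // mulrC.
    by rewrite -mulrA -invfM ler_pdivrMr ?mulr_gt0 // mulrC.
  have -> : H * q * (H * q * f im)^-1 = (f im)^-1.
    by field; rewrite !gt_eqF.
  rewrite -[rescale P y i]/(f i)^-1.
  by apply/andP; split; rewrite lef_pV2 ?posrE ?mulr_gt0.
Qed.

(** The column sums average to 1, so total excess equals total deficit and a lower bound controls
    both. *)
Lemma sk_error_col_ge (R : realType) (n : nat) (W : 'M[R]_n) (s : R) :
  (forall i, row_sum W i = 1) -> s <= 1 -> (forall j, s <= col_sum W j) ->
  sk_error W <= n%:R * (2 * (1 - s)).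
Proof.
move=> W1 s1 Ws; rewrite sk_errorE big1 ?add0r => [|i _]; last first.
  by rewrite W1 subrr normr0.
have cn : \sum_j col_sum W j = n%:R.
  rewrite exchange_big /= -[in RHS](card_ord n) -sumr_const.
  by apply: eq_bigr => i _; exact: W1.
apply: le_trans (_ : \sum_j (col_sum W j - 1 + 2 * (1 - s)) <= _).
  by apply: ler_sum => j _; rewrite ler_norml; have := Ws j; lra.
rewrite big_split /= sumrB cn !sumr_const card_ord subrr add0r.
by rewrite -[leLHS]mulr_natl.
Qed.

(** * Constants free of the dimension, and the iteration count *)

(** Passing from [d] to [delta * n] removes [n] from the constants; [alpha] is [rho^2 delta / K]. *)
Lemma exists_good_balancing (R : realType) (n g g' : nat) (rho delta : R)
    (B : 'M[R]_n) :
  (0 < n)%N -> 0 < rho -> graph_dense g g' rho B -> (n < g + g')%N ->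
  0 < delta -> delta * n%:R <= (g + g' - n)%:R ->
  let K := 27 / (rho ^+ 2 * delta ^+ 3) in
  let alpha := rho ^+ 4 * delta ^+ 4 / 27 in
  exists a b : 'I_n -> R,
    [/\ forall i, 0 < a i, forall j, 0 < b j, bistochastic (scaled a B b),
        forall j l, b l <= K * b j &
        (forall i j, rho <= B i j -> rho / K / n%:R <= scaled a B b i j) /\
        (doeblin alpha (scaled a B b) \/ doeblin alpha (scaled a B b)^T)].
Proof.
move=> n_gt0 rho0 dB ngg delta0 dd K alpha.
have [a [b [a0 b0 biP]]] := exists_balancing n_gt0 rho0 dB ngg.
have ratio := balanced_ratio rho0 dB ngg n_gt0 a0 b0 biP.
have entry := balanced_entry_ge rho0 dB ngg n_gt0 a0 b0 biP.
have Kd0 := balanced_const_gt0 rho0 ngg n_gt0.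
set d := (g + g' - n)%N in dd ratio entry Kd0.
set Kd := 27 * n%:R ^+ 3 / (rho ^+ 2 * d%:R ^+ 3) in ratio entry Kd0.
have n0 : 0 < n%:R :> R by rewrite ltr0n.
have d0 : 0 < d%:R :> R by rewrite ltr0n /d; lia.
have K0 : 0 < K by rewrite divr_gt0 ?mulr_gt0 ?exprn_gt0.
have KdE : Kd = 27 / (rho ^+ 2 * (d%:R / n%:R) ^+ 3).
  by rewrite /Kd; field; rewrite !gt_eqF.
have dn : delta <= d%:R / n%:R by rewrite ler_pdivlMr.
have dn0 : 0 < d%:R / n%:R :> R by rewrite divr_gt0.
have KK : Kd <= K.
  rewrite KdE /K ler_pM2l // lef_pV2 ?posrE ?(mulr_gt0, exprn_gt0, invr_gt0) //.
  by rewrite ler_pM2l ?exprn_gt0 // lerXn2r // nnegrE ltW.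
have aa : alpha <= rho ^+ 2 * d%:R / (Kd * n%:R).
  have -> : rho ^+ 2 * d%:R / (Kd * n%:R) = rho ^+ 4 * (d%:R / n%:R) ^+ 4 / 27.
    by rewrite /Kd; field; rewrite !gt_eqF.
  apply: ler_wpM2r; first by rewrite invr_ge0.
  apply: ler_wpM2l; first by rewrite exprn_ge0 // ltW.
  by rewrite lerXn2r // nnegrE ltW.
exists a, b; split=> // [j l|]; first by apply: le_trans (ratio j l) _; rewrite ler_pM2r.
split=> [i j /entry Eij|].
  apply: le_trans Eij; rewrite -mulrA -invfM ler_pM2l // lef_pV2 ?posrE.
  - by rewrite ler_pM2r.
  - exact: mulr_gt0 K0 n0.
  - exact: mulr_gt0 Kd0 n0.
have [gg|gg] := leqP g g'; [left|right]; apply: doeblin_le aa _.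
  exact: (balanced_doeblin rho0 dB ngg n_gt0 a0 b0 biP gg).
have ngg' : (n < g' + g)%N by rewrite addnC.
have biPT : bistochastic (scaled b B^T a) by rewrite -scaled_tr; exact: bistochastic_tr.
have := balanced_doeblin rho0 (graph_dense_tr dB) ngg' n_gt0 b0 a0 biPT (ltnW gg).
by rewrite [(g' + g)%N]addnC -scaled_tr.
Qed.

Lemma exp27_le1 (R : realType) (z : R) :
  0 <= z <= 2 / 3 -> z ^+ 27 * 27 ^+ 3 <= 1.
Proof.
move=> /andP[z0 z1].
have z3 : z ^+ 3 <= 1 / 3.
  apply: le_trans (_ : (2 / 3) ^+ 3 <= _); last by lra.
  by apply: lerXn2r; rewrite ?nnegrE ?divr_ge0.
have e27 : 27 = 3 ^+ 3 :> R by ring.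
have -> : 27 ^+ 3 = 3 ^+ 9 :> R by rewrite e27 -exprM.
rewrite (exprM z 3 9 : z ^+ 27 = _) -exprMn.
by apply: exprn_ile1; [rewrite mulr_ge0 ?exprn_ge0|move: z3; lra].
Qed.

(** With [X = h / (eps rho delta)], taking [m] just above [76 ln X / alpha] makes the power at most
    [X^-38]. Of these 38 factors, 27 absorb [27^3] because [X > 3/2], ten absorb [rho^-7 delta^-10]
    because [1 / X <= rho delta], and the last one turns [h] into [eps rho delta]. *)
Lemma iteration_count (R : realType) (h eps rho delta : R) :
  1 <= h -> 0 < eps <= 1 -> 0 < rho <= 1 -> 0 < delta <= 1 ->
  3 / 2 < h / (eps * (rho * delta)) ->
  exists m : nat,
    (1 - rho ^+ 4 * delta ^+ 4 / 27 / 2) ^+ m *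
      (27 ^+ 3 * h / (rho ^+ 8 * delta ^+ 11)) <= eps /\
    ((m.*2).+1.*2)%:R <= 8694 * ((ln h - ln eps - ln rho - ln delta) /
                                 (rho ^+ 14 * delta ^+ 6)).
Proof.
move=> h1 /andP[e0 e1] /andP[r0 r1] /andP[d0 d1] X32.
have h0 : 0 < h by apply: lt_le_trans h1.
set X := h / _ in X32.
have X0 : 0 < X by rewrite divr_gt0 ?mulr_gt0.
set E := ln h - _ - _ - _.
have EX : E = ln X.
  by rewrite /X ln_div ?posrE ?mulr_gt0 // !lnM ?posrE ?mulr_gt0 // /E; ring.
have XE : expR E = X by rewrite EX lnK.
have X23 : X^-1 < 2 / 3.
  by rewrite -[2 / 3]invrK ltf_pV2 ?posrE ?invr_gt0 // ?divr_gt0 // invf_div.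
have E3 : 1 / 3 < E.
  have : 1 - E <= X^-1 by rewrite -XE -expRN; have := expR_ge1Dx (- E); lra.
  by move: X23; lra.
have E0 : 0 < E by apply: lt_trans E3; lra.
set alpha := rho ^+ 4 * delta ^+ 4 / 27.
have alpha0 : 0 < alpha by rewrite !mulr_gt0 ?exprn_gt0 ?invr_gt0.
have r4 : rho ^+ 4 * delta ^+ 4 <= 1.
  by rewrite mulr_ile1 ?exprn_ge0 ?exprn_ile1 ?(ltW r0) ?(ltW d0).
have alpha1 : alpha <= 1.
  by rewrite /alpha ler_pdivrMr //; apply: le_trans r4 _; rewrite mul1r; lra.
have [m mhi mR] : exists2 m : nat,
    76 * E / alpha < m%:R & m%:R <= 76 * E / alpha + 1.
  have q0 : 0 <= 76 * E / alpha.
    by apply: divr_ge0; [apply: mulr_ge0 => //; exact: ltW|exact: ltW].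
  have /andP[lo hi] := truncn_itv q0.
  by exists (Num.trunc (76 * E / alpha)).+1; rewrite // -natr1 lerD2r.
exists m; split.
  have pow : (1 - alpha / 2) ^+ m <= X^-1 ^+ 38.
    apply: le_trans (_ : expR (- (alpha / 2)) ^+ m <= _).
      rewrite lerXn2r ?nnegrE ?expR_ge0 //; first by move: alpha1; lra.
      exact: expR_ge1Dx.
    rewrite -expRM_natr -XE -expRN -expRM_natr ler_expR.
    move: mhi; rewrite ltr_pdivrMr // => {}mhi.
    rewrite !mulNr lerN2; move: mhi; set z := m%:R; lra.
  have Xi : 0 < X^-1 by rewrite invr_gt0.
  have Xpow : X^-1 ^+ 38 * 27 ^+ 3 * h / (rho ^+ 8 * delta ^+ 11) <= eps.
    have c27 : X^-1 ^+ 27 * 27 ^+ 3 <= 1.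
      by apply: exp27_le1; rewrite !ltW.
    have Xrd : X^-1 <= rho * delta.
      rewrite /X invf_div ler_pdivrMr // mulrC ler_pM2l ?mulr_gt0 //.
      exact: le_trans e1 h1.
    have c10 : X^-1 ^+ 10 / (rho ^+ 7 * delta ^+ 10) <= 1.
      rewrite ler_pdivrMr ?mulr_gt0 ?exprn_gt0 // mul1r.
      apply: le_trans (_ : (rho * delta) ^+ 10 <= _).
        by apply: lerXn2r => //; rewrite nnegrE ltW // mulr_gt0.
      rewrite exprMn ler_pM2r ?exprn_gt0 //.
      by apply: ler_wiXn2l => //; exact: ltW.
    have Xh : X^-1 * h = eps * (rho * delta).
      by rewrite /X invf_div divfK // gt_eqF.
    have -> : X^-1 ^+ 38 * 27 ^+ 3 * h / (rho ^+ 8 * delta ^+ 11) =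
        X^-1 ^+ 27 * 27 ^+ 3 * (X^-1 ^+ 10 / (rho ^+ 7 * delta ^+ 10)) * eps.
      have -> : X^-1 ^+ 38 * 27 ^+ 3 * h =
          X^-1 ^+ 27 * 27 ^+ 3 * X^-1 ^+ 10 * (X^-1 * h).
        rewrite (exprD _ 27 11 : X^-1 ^+ 38 = _) (exprSr _ 10).
        by move: (X^-1 ^+ 27) (X^-1 ^+ 10) (27 ^+ 3) => p q c; ring.
      rewrite Xh; move: (X^-1 ^+ 27 * 27 ^+ 3) (X^-1 ^+ 10) => p q.
      by field; rewrite !gt_eqF.
    rewrite -[leRHS]mul1r ler_pM2r //.
    apply: mulr_ile1 => //.
      by rewrite mulr_ge0 // exprn_ge0 // ltW.
    by apply: divr_ge0; [|apply: mulr_ge0]; apply: exprn_ge0; exact: ltW.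
  set c := 27 ^+ 3 * h / _.
  have c0 : 0 <= c by apply: divr_ge0; apply: mulr_ge0; rewrite ?exprn_ge0 // ltW.
  apply: le_trans (_ : X^-1 ^+ 38 * c <= _); first by rewrite ler_wpM2r.
  move: Xpow; rewrite /c.
  by move: (X^-1 ^+ 38) (27 ^+ 3) (_ ^-1) => p q s; rewrite !mulrA.
have kE : ((m.*2).+1.*2)%:R = 2 + 4 * m%:R :> R.
  by rewrite -!mul2n natrM -[(2 * m).+1%:R]natr1 natrM; ring.
have Ea : E <= E / alpha.
  by rewrite ler_pdivlMr // -[leRHS]mulr1 ler_pM2l.
(* [4 m + 2 <= 304 E / alpha + 6], and [6 <= 18 E] as [E > 1/3]; finally [8694 = 322 * 27]. *)
apply: le_trans (_ : 322 * (E / alpha) <= _).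
  rewrite kE; move: mR; rewrite -[76 * E / alpha]mulrA.
  by move: (E / alpha) Ea => z Ez; move: E3 Ez; set k := m%:R; lra.
have -> : 322 * (E / alpha) = 8694 * (E / (rho ^+ 4 * delta ^+ 4)).
  by rewrite /alpha; field; rewrite !gt_eqF.
rewrite ler_pM2l // ler_pM2l // lef_pV2 ?posrE ?mulr_gt0 ?exprn_gt0 //.
by rewrite ler_pM ?exprn_ge0 ?(ltW r0) ?(ltW d0) //; apply: ler_wiXn2l => //;
  exact: ltW.
Qed.

Lemma sk_error_bound (R : realType) (n g g' : nat) (rho delta eps t h : R)
    (A B : 'M[R]_n) (u v : 'rV[R]_n) :
  (0 < n)%N -> 0 < rho <= 1 -> 0 < delta <= 1 -> 0 < eps <= 1 -> 0 < t ->
  graph_dense g g' rho (t^-1 *: B) -> (n < g + g')%N ->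
  delta * n%:R <= (g + g' - n)%:R ->
  (forall i, 0 < u 0 i) -> (forall j, 0 < v 0 j) ->
  diag_mx u *m A *m diag_mx v = B ->
  (forall i j, row_sum A i * B i j <= h * (row_sum B i * A i j)) ->
  exists k : nat,
    k%:R <= 8694 * ((ln h - ln eps - ln rho - ln delta) /
                    (rho ^+ 14 * delta ^+ 6)) /\
    forall l, (k <= l)%N -> sk_error (SK A l) <= n%:R * eps.
Proof.
move=> n_gt0 /andP[r0 r1] /andP[dl0 dl1] /andP[e0 e1] t0 dB ngg dd u0 v0 UAV hAB.
have n0 : 0 < n%:R :> R by rewrite ltr0n.
have [a [b [a0 b0 biP ratio [entry doe]]]] :=
  exists_good_balancing n_gt0 r0 dB ngg dl0 dd.
set K := 27 / _ in ratio entry.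
set P := scaled a _ b in biP entry doe.
have [[P0 P1] sPT] := biP.
have BE i j : B i j = u 0 i * A i j * v 0 j.
  by rewrite -UAV mul_mx_diag mul_diag_mx !mxE.
have PE i j : P i j = a i * (t^-1 * B i j) * b j by rewrite !mxE.
pose x i := t / (a i * u 0 i); pose y j := (b j * v 0 j)^-1.
have x0 i : 0 < x i by rewrite divr_gt0 ?mulr_gt0.
have y0 j : 0 < y j by rewrite invr_gt0 mulr_gt0.
have AE : A = scaled x P y.
  apply/matrixP => i j; rewrite mxE PE BE /x /y.
  by field; rewrite !gt_eqF.
have Aij i j : A i j = x i * P i j * y j by rewrite {1}AE mxE.
pose f i := \sum_l P i l * y l.
have f0 i : 0 < f i by apply: (@wmean_gt0 _ _ (P i)).
have rA i : row_sum A i = x i * f i.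
  by rewrite AE row_sum_scaled /rescale invrK.
pose s i := \sum_l P i l * (b l)^-1.
have s0 i : 0 < s i by apply: (@wmean_gt0 _ _ (P i)) => // l; rewrite invr_gt0.
have BP i j : B i j = t / a i * (P i j * (b j)^-1).
  by rewrite PE; field; rewrite !gt_eqF.
have rB i : row_sum B i = t / a i * s i.
  by rewrite mulr_sumr; apply: eq_bigr => j _; exact: BP.
have rA0 i : 0 < row_sum A i by rewrite rA mulr_gt0.
have rB0 i : 0 < row_sum B i by rewrite rB mulr_gt0 ?divr_gt0.
have A0 i j : 0 <= A i j by rewrite AE; apply: nonneg_scaled.
(* Summing the hypothesis on [h] over a row gives the same product of row sums on both sides. *)
have h1 : 1 <= h.
  pose i0 := Ordinal n_gt0.
  have : \sum_j row_sum A i0 * B i0 j <= \sum_j h * (row_sum B i0 * A i0 j).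
    exact: ler_sum.
  rewrite -!mulr_sumr -/(row_sum A i0) -/(row_sum B i0) mulrC.
  by rewrite -[leLHS]mul1r ler_pM2r // mulr_gt0.
have h0 : 0 < h by apply: lt_le_trans h1.
have K1 : 1 <= K.
  rewrite ler_pdivlMr ?mulr_gt0 ?exprn_gt0 // mul1r.
  apply: le_trans (_ : 1 <= _); last by rewrite ler1n.
  by rewrite mulr_ile1 ?exprn_ge0 ?exprn_ile1 ?(ltW r0) ?(ltW dl0).
have K0 : 0 < K by apply: lt_le_trans K1.
have [B01 Br Bc] := dB.
have dn : (0 < g + g' - n)%N by rewrite subn_gt0.
set d := (g + g' - n)%N in dd dn.
have d0 : 0 < d%:R :> R by rewrite ltr0n.
set X := h / (eps * (rho * delta)).
(* If [X] is close to 1 the bound on [k] may be below 1, so that [k = 0]; then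
   the row-normalized [A] is already close enough to balanced. *)
have [X32|X32] := ltP (3 / 2) X.
- have [m [m1 m2]] : exists m : nat, _ :=
    iteration_count h1 (introT andP (conj e0 e1)) (introT andP (conj r0 r1))
      (introT andP (conj dl0 dl1)) X32.
  (* One initial round and [m] contractions of two rounds each, every round being two
     normalizations. *)
  exists ((m.*2).+1.*2)%N; split=> // l lk.
  rewrite AE; apply: le_trans (sk_error_nonincr biP x0 y0 lk) _.
  set alpha := rho ^+ 4 * delta ^+ 4 / 27 in doe m1.
  have alpha01 : 0 <= alpha <= 1.
    rewrite divr_ge0 ?mulr_ge0 ?exprn_ge0 ?(ltW r0) ?(ltW dl0) //=.
    rewrite ler_pdivrMr // mul1r; apply: le_trans (_ : 1 <= _); last by rewrite ler1n.
    by rewrite mulr_ile1 ?exprn_ge0 ?exprn_ile1 ?(ltW r0) ?(ltW dl0).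
  (* This is [h K (K / (rho delta))^2], the spread after the first round with [beta = rho / K] and
     [H = h K]. *)
  set k0 := 27 ^+ 3 * h / _ in m1.
  have start : spread k0 (sk_step P y).
    have bt : 0 < rho / K <= 1.
      by rewrite divr_gt0 //= ler_pdivrMr // mul1r (le_trans r1).
    have : spread (h * K * (n%:R / (rho / K * d%:R)) ^+ 2) (sk_step P y).
      apply: (@spread_sk_step_start R n g g' d P
        (fun i j => rho <= (t^-1 *: B) i j) (rho / K) (h * K) y n_gt0 biP dn _
        Br Bc bt entry y0 (mulr_gt0 h0 K0)).
        by rewrite subnKC // ltnW.
      move=> i j Eij.
      have Pij : 0 < P i j by apply: lt_le_trans (entry i j Eij); rewrite divr_gt0 // divr_gt0.
      (* In terms of [P], the row sum of [B] involves [1 / b]; the ratio bound on [b] converts the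
         hypothesis on [h] into [f i <= h K * y j] at heavy entries. *)
      have bs : b j * s i <= K.
        have -> : b j * s i = \sum_l P i l * (b j / b l).
          by rewrite mulr_sumr; apply: eq_bigr => z _; ring.
        by apply: (@wmean_le _ _ (P i)) => // z; rewrite ler_pdivrMr.
      have := hAB i j; rewrite rA rB BP Aij.
      have -> : x i * f i * (t / a i * (P i j * (b j)^-1)) =
         (x i * (t / a i) * P i j * (b j)^-1) * f i by ring.
      have -> : h * (t / a i * s i * (x i * P i j * y j)) =
         (x i * (t / a i) * P i j * (b j)^-1) * (h * (b j * s i) * y j).
        by field; rewrite !gt_eqF.
      have c0 : 0 < x i * (t / a i) * P i j * (b j)^-1.
        by rewrite divr_gt0 // mulr_gt0 // mulr_gt0 // divr_gt0.
      rewrite (ler_pM2l c0).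
      move/le_trans; apply; apply: ler_wpM2r; first exact: ltW.
      by apply: ler_wpM2l => //; exact: ltW.
    apply: spread_le.
    have -> : k0 = h * K * (delta * (rho / K))^-1 ^+ 2.
      by rewrite /k0 /K; field; rewrite !gt_eqF.
    rewrite (ler_pM2l (mulr_gt0 h0 K0)); apply: lerXn2r.
    - by rewrite nnegrE ltW // divr_gt0 // mulr_gt0 // divr_gt0.
    - by rewrite nnegrE ltW // invr_gt0 mulr_gt0 // divr_gt0.
    rewrite -[leLHS]invf_div lef_pV2 ?posrE.
    - rewrite [leLHS]mulrC -[leRHS]mulrA; apply: ler_wpM2l; last by rewrite ler_pdivlMr.
      by rewrite ltW // divr_gt0.
    - by rewrite divr_gt0 // mulr_gt0 // divr_gt0.
    - by rewrite mulr_gt0 // divr_gt0.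
  have k01 := spread_ge1 n_gt0 start.
  have := sk_scaling_contract m biP alpha01 doe k01 start.
  rewrite /sk_scaling -iterSr => sp.
  apply: le_trans (sk_error_spread biP x0 y0 sp) _.
  rewrite ler_pM2l // [1 + _]addrC addrK.
  apply: le_trans m1; apply: ler_wpM2l.
    by rewrite exprn_ge0 //; case/andP: alpha01; lra.
  by rewrite gerBl.
exists 0%N; split.
  have X1 : 1 <= X.
    rewrite ler_pdivlMr ?mulr_gt0 // mul1r; apply: le_trans h1.
    by rewrite mulr_ile1 ?mulr_ge0 ?mulr_ile1 ?(ltW r0) ?(ltW dl0) ?(ltW e0).
  have -> : ln h - ln eps - ln rho - ln delta = ln X.
    by rewrite /X ln_div ?posrE ?mulr_gt0 // !lnM ?posrE ?mulr_gt0 //; ring.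
  rewrite mulr_ge0 // divr_ge0 ?ln_ge0 //.
  by rewrite mulr_ge0 ?exprn_ge0 ?(ltW r0) ?(ltW dl0).
move=> l _; rewrite AE; apply: le_trans (sk_error_nonincr biP x0 y0 (leq0n l)) _.
rewrite -AE /=.
(* A lower bound on the column sums after the first row normalization: each of the at least
   [delta * n] heavy rows contributes at least [rho / (n h)]. *)
set q := rho * delta / h.
have q1 : q <= 1.
  rewrite ler_pdivrMr // mul1r; apply: le_trans h1.
  by rewrite mulr_ile1 ?(ltW r0) ?(ltW dl0).
apply: le_trans (sk_error_col_ge _ q1 _) _.
- move=> i; rewrite /row_sum; under eq_bigr => j _ do rewrite mxE.
  by rewrite -mulr_suml divff // gt_eqF // rA0.
- move=> j; rewrite /col_sum; under eq_bigr => i _ do rewrite mxE.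
  have g'd : delta * n%:R <= g'%:R.
    apply: le_trans dd _; rewrite ler_nat leq_subLR leq_add2r.
    by have := leq_trans (Br (Ordinal n_gt0)) (max_card _); rewrite card_ord.
  set N := [set i | (rho <= (t^-1 *: B) i j)%R].
  rewrite [leRHS](bigID (mem N)) /=; apply: ler_wpDr.
    by apply: sumr_ge0 => i _; rewrite divr_ge0 // ltW.
  apply: le_trans (_ : \sum_(i in N) rho / (n%:R * h) <= _).
    rewrite sumr_const -[leRHS]mulr_natr.
    have -> : q = rho / (n%:R * h) * (delta * n%:R).
      by rewrite /q; field; rewrite !gt_eqF.
    rewrite ler_pM2l ?divr_gt0 ?mulr_gt0 //; apply: le_trans g'd _.
    by rewrite ler_nat; exact: Bc.
  apply: ler_sum => i; rewrite inE mxE => Bij.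
  have rBn : row_sum B i <= n%:R * t.
    apply: le_trans (_ : \sum_(l < n) t <= _).
      apply: ler_sum => k _; have /andP[_] := B01 i k.
      by rewrite mxE ler_pdivrMl // mulr1.
    by rewrite sumr_const card_ord -[leLHS]mulr_natl.
  rewrite ler_pdivrMr ?mulr_gt0 // mulrAC ler_pdivlMr ?rA0 //.
  have nt : 0 < n%:R * t by rewrite mulr_gt0.
  rewrite -(ler_pM2l t0); apply: le_trans (_ : row_sum A i * B i j <= _).
    rewrite mulrA mulrC ler_pM2l ?rA0 //.
    by move: Bij; rewrite ler_pdivlMl // mulrC.
  apply: le_trans (hAB i j) _.
  have -> : t * (A i j * (n%:R * h)) = h * (n%:R * t * A i j) by ring.
  by rewrite ler_pM2l // ler_wpM2r.
rewrite ler_pM2l //.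
(* Both [eps] and [q] are then at least [2 / 3], whence [2 (1 - q) <= 2 / 3 <= eps]. *)
have eq23 : 2 / 3 <= eps * q.
  have -> : eps * q = X^-1 by rewrite /q /X; field; rewrite !gt_eqF.
  by rewrite -[2 / 3]invf_div lef_pV2 ?posrE ?divr_gt0 ?mulr_gt0.
have q0 : 0 < q by rewrite divr_gt0 ?mulr_gt0.
have : eps * q <= eps by rewrite -[leRHS]mulr1 ler_pM2l.
have : eps * q <= q by rewrite -[leRHS]mul1r ler_pM2r.
by move: (eps * q) eq23 => z; lra.
Qed.

(** * From proportions and maxima to degrees and inequalities *)

Lemma max_entry_ge (R : realType) (n : nat) (M : 'M[R]_n) (i j : 'I_n) :
  M i j <= max_entry M.
Proof.
apply: le_trans (_ : \big[Num.max/0]_(k < n) M i k <= _).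
  exact: (le_bigmax _ (fun k => M i k)).
exact: (le_bigmax _ (fun l => \big[Num.max/0]_(k < n) M l k)).
Qed.

Lemma max_entry_gt0 (R : realType) (n : nat) (M : 'M[R]_n) :
  M != 0 -> nonneg_mx M -> 0 < max_entry M.
Proof.
move=> M0 Mge; rewrite ltNge; apply: contra M0 => Mle.
apply/eqP/matrixP => i j; rewrite mxE; apply/eqP.
by rewrite eq_le Mge andbT (le_trans (max_entry_ge M i j)).
Qed.

Lemma min_card_density (R : realType) (n : nat) (F : 'I_n -> {set 'I_n}) :
  (0 < n)%N ->
  exists2 m : nat, (forall i, m <= #|F i|)%N &
    \big[Num.min/1]_(i < n) (#|F i|%:R / n%:R) <= m%:R / n%:R :> R.
Proof.
case: n F => // n F _.
have [im _ imP] := arg_minnP (fun i => #|F i|) (isT : predT (ord0 : 'I_n.+1)).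
exists #|F im| => [i|]; first exact: imP.
exact: (bigmin_le 1 im (fun i => #|F i|%:R / n.+1%:R : R)).
Qed.

Lemma scaling_ratio_ge (R : realType) (n : nat) (A B : 'M[R]_n)
    (i j : 'I_n) :
  0 < row_sum B i -> 0 < A i j ->
  row_sum A i * B i j <= scaling_ratio A B * (row_sum B i * A i j).
Proof.
move=> r0 Aij; rewrite -ler_pdivrMr ?mulr_gt0 //.
pose F k l := row_sum A k * B k l / (row_sum B k * A k l).
apply: le_trans (_ : \big[Num.max/0]_(l < n | 0 < A i l) F i l <= _).
  exact: (le_bigmax_cond 0 (F i)).
exact: (le_bigmax _ (fun k => \big[Num.max/0]_(l < n | 0 < A k l) F k l)).
Qed.

Theorem theorem4p1 (R : realType) :
  exists C : R, 0 < C /\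
    forall (gamma gamma' rho eps : R) (n : nat) (A B : 'M[R]_n)
      (u v : 'rV[R]_n),
      0 < gamma <= 1 -> 0 < rho <= 1 -> 0 < eps <= 1 ->
      1 - gamma < gamma' <= 1 ->
      (0 < n)%N ->
      nonneg_mx B -> dense gamma gamma' rho B ->
      (forall i, 0 < u 0 i) -> (forall j, 0 < v 0 j) ->
      diag_mx u *m A *m diag_mx v = B ->
      exists k : nat,
        k%:R <= C * ((ln (scaling_ratio A B) - ln eps - ln rho
                        - ln (gamma + gamma' - 1))
                     / (rho ^+ 14 * (gamma + gamma' - 1) ^+ 6)) /\
        forall l : nat, (k <= l)%N ->
          l1norm (row_sums (SK A l) - const_mx 1)
            + l1norm (col_sums (SK A l) - const_mx 1) <= n%:R * eps.
Proof.
exists 8694; split=> // gamma gamma' rho eps n A B u v /andP[ga0 ga1] rho01 eps01.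
move=> /andP[gg ga1'] n_gt0 _ [B0 Bge gE gE'] u0 v0 UAV.
have rho0 : 0 < rho by case/andP: rho01.
have t0 := max_entry_gt0 B0 Bge; set t := max_entry B in t0.
have n0 : 0 < n%:R :> R by rewrite ltr0n.
have [g gP gle] := @min_card_density R n (fun i => [set k | B i k > rho * t]) n_gt0.
have [g' gP' gle'] := @min_card_density R n (fun j => [set k | B k j > rho * t]) n_gt0.
rewrite -/(min_row_density rho B) -gE ler_pdivlMr // in gle.
rewrite -/(min_col_density rho B) -gE' ler_pdivlMr // in gle'.
set delta := gamma + gamma' - 1.
have dl0 : 0 < delta by rewrite /delta; lra.
have dl1 : delta <= 1 by rewrite /delta; lra.
have dn : delta * n%:R + n%:R <= (g + g')%:R.
  have -> : delta * n%:R + n%:R = gamma * n%:R + gamma' * n%:R.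
    by rewrite /delta; ring.
  by rewrite natrD lerD.
have ngg : (n < g + g')%N.
  by rewrite -(ltr_nat R); apply: lt_le_trans dn; rewrite ltrDr mulr_gt0.
have dB : graph_dense g g' rho (t^-1 *: B).
  have heavy i j : rho * t < B i j -> rho <= (t^-1 *: B) i j.
    by move=> Bij; rewrite mxE ler_pdivlMl // mulrC ltW.
  split=> [i j|i|j].
  - by rewrite mxE ler_pdivrMl // mulr1 max_entry_ge andbT mulr_ge0 // invr_ge0 ltW.
  - apply: leq_trans (gP i) _; apply: subset_leq_card; apply/subsetP => j.
    by rewrite !inE; exact: heavy.
  - apply: leq_trans (gP' j) _; apply: subset_leq_card; apply/subsetP => i.
    by rewrite !inE; exact: heavy.
apply: (sk_error_bound n_gt0 rho01 _ eps01 t0 dB ngg _ u0 v0 UAV).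
- by rewrite dl0.
- by rewrite natrB ?(ltnW ngg) // lerBrDr.
move=> i j.
have BE k l : B k l = u 0 k * A k l * v 0 l.
  by rewrite -UAV mul_mx_diag mul_diag_mx !mxE.
have uv0 k l : 0 < u 0 k * v 0 l by rewrite mulr_gt0.
have A_ge0 k l : 0 <= A k l.
  by rewrite -(pmulr_rge0 _ (uv0 k l)) mulrAC -BE Bge.
(* Where [A i j = 0], a pair excluded from the maximum, [B i j] vanishes too and the inequality is
   trivial. *)
have := A_ge0 i j; rewrite le_eqVlt => /orP[/eqP A0|A0].
  by rewrite BE -A0 !(mulr0, mul0r).
apply: scaling_ratio_ge => //; rewrite /row_sum (bigD1 j) //=.
apply: ltr_pwDl; first by rewrite BE mulrAC mulr_gt0.
by apply: sumr_ge0 => k _.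
Qed.
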